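(* Let $f\in\mathcal{U}^2$ be a piecewise expanding $C^2$ unimodal map whose critical point $c=0$ is not periodic. Then for every $\beta\in(0,1)$ there exist $C_\beta>0$ and a neighbourhood $\mathcal{V}_\beta$ of $f$ in $\mathcal{U}^2$ (for the $\mathcal{B}^2$-norm) such that, for every $g\in\mathcal{V}_\beta$ and every $\beta$-Hölder function $v:I\to\mathbb{R}$ with $v(-1)=v(1)=0$ and $J(g,v)=0$, the unique bounded function $\alpha:I\to\mathbb{R}$ satisfying $\alpha(c)=0$ and $$v(x)=\alpha(g(x))-g'(x)\,\alpha(x)\quad\text{for all } x\in I,\ x\neq c,$$ is $\beta$-Hölder, with $$|\alpha|_\beta\le C_\beta\,|v|_\beta .$$ If instead the critical point of $f\in\mathcal{U}^2$ is periodic, then for every $\beta\in(0,1)$ there exist $C_\beta>0$ and $\xi(\beta)>0$ such that, setting $$\mathcal{V}_\beta=\{g\in\mathcal{U}^2 \mid \|g-f\|_{\mathcal{B}^2}<\xi(\beta),\ \text{there exists a homeomorphism } h:I\to I \text{ with } g\circ h=h\circ f\},$$ for every $g\in\mathcal{V}_\beta$ and every $\beta$-Hölder function $v:I\to\mathbb{R}$ with $v(-1)=v(1)=0$ and $J(g,v)=0$, the unique bounded function $\alpha:I\to\mathbb{R}$ satisfying $\alpha(c)=0$ and $v(x)=\alpha(g(x))-g'(x)\,\alpha(x)$ for all $x\in I$, $x\neq c$, is $\beta$-Hölder, with $|\alpha|_\beta\le C_\beta\,|v|_\beta$.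
   Context: $I=[-1,1]$ and $c=0$. For an integer $k\ge1$, $\mathcal{B}^k$ is the Banach space of continuous functions $f:I\to\mathbb{R}$ whose restrictions to $[-1,0]$ and to $[0,1]$ are $C^k$, with norm $\|f\|_{\mathcal{B}^k}=\max\{|f|_{C^k([-1,0])},|f|_{C^k([0,1])}\}$. The set $\mathcal{U}^k$ of piecewise expanding $C^k$ unimodal maps consists of the $f\in\mathcal{B}^k$ such that $f(-1)=f(1)=-1$, $\inf_{x\ne0}|f'(x)|>1$ and $f(0)\le1$ (so $f(I)\subset I$). The point $c=0$ is called the critical point of $f$. For $f\in\mathcal{U}^k$ and $j\ge 0$ put $c_j=f^j(c)$. Set $M_f=q$ if $c$ is periodic for $f$ with minimal period $q$, and $M_f=+\infty$ otherwise. For bounded $v:I\to\mathbb{R}$, $$J(f,v)=\sum_{j=0}^{M_f-1}\frac{v(c_j)}{(f^j)'(c_1)}.$$ For any $g\in\mathcal{U}^1$ and any bounded $v:I\to\mathbb{R}$, the equation $v(x)=\alpha(g(x))-g'(x)\alpha(x)$ for all $x\ne c$ is known to have a unique bounded solution $\alpha:I\to\mathbb{R}$ with $\alpha(c)=0$. For a $\beta$-Hölder function $u:I\to\mathbb{R}$, $|u|_\beta$ denotes its $\beta$-Hölder norm. *)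

(* Defs.v *)
From HB Require Import structures.
From mathcomp Require Import all_boot all_order all_algebra.
From mathcomp Require Import all_classical all_reals all_analysis.

Set Implicit Arguments.
Unset Strict Implicit.
Unset Printing Implicit Defensive.

Import Order.TTheory GRing.Theory Num.Theory.
Import numFieldNormedType.Exports.

Local Open Scope classical_set_scope.
Local Open Scope ring_scope.

Section PiecewiseExpandingUnimodal.
Context {R : realType}.
Implicit Types (D : set R) (f g u v alpha : R -> R) (k : nat) (beta : R).

(* A map on a subset of R is represented by a function R -> R; every notion
   below depends only on its values on that subset. *)
Definition I : set R := `[-1, 1].

(* Derivatives relative to D: one-sided at the endpoints when D is a closed
   interval, equal to the usual derivative in its interior. *)
Definition diff_quot f (x y : R) : R := (f y - f x) / (y - x).

Definition derivable_in D f (x : R) : Prop :=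
  cvg (diff_quot f x y @[y --> within D x^']).

Definition derive_in D f (x : R) : R :=
  lim (diff_quot f x y @[y --> within D x^']).

Definition deriven_in D (j : nat) f : R -> R := iter j (derive_in D) f.

Definition Ck_on k D f : Prop :=
  (forall j, (j < k)%N -> forall x, D x -> derivable_in D (deriven_in D j f) x)
  /\ (forall j, (j <= k)%N -> {within D, continuous (deriven_in D j f)}).

Definition sup_norm D u : R := sup [set `|u x| | x in D].

(* The C^k norm is the maximum, over j <= k, of the sup norms of the j-th
   derivatives. *)
Definition Ck_norm k D f : R :=
  \big[Num.max/0]_(j < k.+1) sup_norm D (deriven_in D j f).

Definition in_B k f : Prop :=
  [/\ {within I, continuous f}, Ck_on k `[-1, 0] f & Ck_on k `[0, 1] f].

Definition B_norm k f : R :=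
  Num.max (Ck_norm k `[-1, 0] f) (Ck_norm k `[0, 1] f).

(* The inclusion f(I) `<=` I is stated explicitly: the other clauses alone do
   not exclude the maps that decrease on [-1, 0] and increase on [0, 1], such
   as x |-> 2 * `|x| - 3. *)
Definition in_U k f : Prop :=
  [/\ in_B k f,
      f (-1) = -1 /\ f 1 = -1,
      1 < inf [set `|derive_in I f x| | x in I `\ 0],
      f 0 <= 1 &
      f @` I `<=` I].

Definition nbhd_in_U k f (V : set (R -> R)) : Prop :=
  V `<=` in_U k /\
  exists2 d : R, 0 < d &
    [set g | in_U k g /\ B_norm k (g \- f) < d] `<=` V.

Definition crit_orbit f (j : nat) : R := iter j f 0.

Definition crit_periodic f : Prop :=
  exists q : nat, (0 < q)%N && (crit_orbit f q == 0).

(* M_f, with None standing for +oo. *)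
Definition crit_period f : option nat :=
  match pselect (crit_periodic f) with
  | left per => Some (ex_minn per)
  | right _ => None
  end.

Definition J f v : R :=
  let term j := v (crit_orbit f j) / derive_in I (iter j f) (crit_orbit f 1) in
  match crit_period f with
  | Some q => \sum_(0 <= j < q) term j
  | None => limn (series term)
  end.

Definition is_holder beta u : Prop :=
  exists K : R, forall x y, I x -> I y ->
    `|u x - u y| <= K * `|x - y| `^ beta.

Definition holder_seminorm beta u : R :=
  sup [set r | exists x y, [/\ I x, I y, x != y &
                              r = `|u x - u y| / `|x - y| `^ beta]].

Definition holder_norm beta u : R := sup_norm I u + holder_seminorm beta u.

Definition tce_solution g v alpha : Prop :=
  [/\ [bounded alpha x | x in I],
      alpha 0 = 0 &
      forall x, I x -> x != 0 ->
        v x = alpha (g x) - derive_in I g x * alpha x].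

Definition homeo_I (h : R -> R) : Prop :=
  exists h' : R -> R,
    [/\ h @` I `<=` I /\ h' @` I `<=` I,
        (forall x, I x -> h' (h x) = x) /\ (forall y, I y -> h (h' y) = y),
        {within I, continuous h} & {within I, continuous h'}].

(* For a map with a unique bounded solution of the equation, as is the case
   for every g in U^1, this says that this solution is beta-Hoelder with norm
   at most C times that of v; existence and uniqueness (on I) are part of the
   claim. *)
Definition holder_tce_bound beta (C : R) g v : Prop :=
  exists alpha,
    [/\ tce_solution g v alpha,
        (forall alpha', tce_solution g v alpha' ->
           forall x, I x -> alpha' x = alpha x),
        is_holder beta alpha &
        holder_norm beta alpha <= C * holder_norm beta v].

End PiecewiseExpandingUnimodal.

(* Main.v *)
Require Import Defs.
From mathcomp Require Import all_boot all_order all_algebra.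
From mathcomp Require Import all_classical all_reals all_analysis.
From mathcomp Require Import ring lra.

Import Order.TTheory GRing.Theory Num.Theory.
Import numFieldNormedType.Exports.

Local Open Scope classical_set_scope.
Local Open Scope ring_scope.

(** The coefficient in front of [alpha x] in the equation is the slope of [g],
    at least [lam > 1] in absolute value, so solving for [alpha x] contracts:
    there is exactly one bounded solution and it is bounded by
    [sup |v| / (lam - 1)] ([tce_solution_exists], [tce_solution_unique],
    [tce_solution_bound]).  Dividing the equation at [g^j 0] by the slope of
    [g^j] and summing telescopes to [J g v = v 0 - alpha (g 0)] ([J_eq]).  Hence
    [J g v = 0] says precisely that the equation survives at the critical point:
    as [alpha 0 = 0], it holds there for either one-sided slope.

    For two points [x], [y] on the same closed side of 0, subtracting the two
    equations bounds [|alpha x - alpha y|] by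
    [|alpha (g x) - alpha (g y)| / |g' x|] plus a multiple of [|x - y|^beta].
    Up to distortion, negligible at small scales, [|g x - g y|^beta / |g' x|] is
    at most [lam^(beta - 1) * |x - y|^beta], and [beta < 1] makes this a
    contraction by some [kappa < 1] ([image_pow_contracts], [pullback]).  This
    can be iterated as long as the two orbits stay on the same side.  When they first
    get separated by 0, the pair is replaced by two pairs with 0 as one member,
    which costs a factor 2.  The factor is affordable if it is paid at most once
    in [N] steps with [2 * kappa^N <= 1/2] ([holder_block]).

    This is where the critical orbit enters.  For [j <= N] a point close enough
    to 0 must have its [j]-th image on the same closed side as [g^j 0]
    ([near_crit_same_side]).  This is clear when [|g^j 0|] is bounded below, and
    trivial when [g^j 0 = 0].  The first alternative passes from [f] to nearby
    [g] by continuity, the second one has to be preserved exactly: for [f]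
    with non-periodic critical point it concerns [j = 0] only, and for periodic
    critical point it is preserved by the conjugacy, which must fix 0 because 0
    is the only point with no second preimage of its image
    ([conjugacy_crit_orbit]).  So both halves of the theorem are instances of
    [uniform_holder_tce].

    A priori [alpha] is only bounded, hence Hoelder up to an additive error.
    Each block of [N] steps halves that error and reproduces the Hoelder
    constant, so the error disappears in the limit ([holder_of_tce]). *)

(** * Derivatives relative to a subset of the line *)

Definition has_derive_in {R : realType} (D : set R) (f : R -> R) (x l : R) :=
  diff_quot f x y @[y --> within D x^'] --> l.

Lemma within_dnbhs_proper {R : realType} (D : set R) (x : R) :
  limit_point D x -> ProperFilter (within D x^').
Proof.
move=> Dx; split; last exact: within_filter.
rewrite /within/= => H; have [y [yx Dy Uy]] := Dx _ H.
exact: Uy yx Dy.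
Qed.

Lemma limit_point_itv {R : realType} (a b x : R) :
  a < b -> a <= x <= b -> limit_point `[a, b]%classic x.
Proof.
move=> ab /andP[ax xb] U Ux; have [xltb|bx] := ltP x b.
- have [y [Uy yx yb]] : exists y, [/\ U y, x < y & y < b].
    apply: (@filter_ex _ (x^'+)); near=> y; split; near: y.
    + exact: (cvg_within _ Ux).
    + exact: nbhs_right_gt.
    + exact: nbhs_right_lt.
  exists y; split; rewrite ?gt_eqF//= in_itv/=; lra.
- have [y [Uy yx yb]] : exists y, [/\ U y, y < x & a < y].
    apply: (@filter_ex _ (x^'-)); near=> y; split; near: y.
    + exact: (cvg_within _ Ux).
    + exact: nbhs_left_lt.
    + apply: nbhs_left_gt; lra.
  exists y; split; rewrite ?lt_eqF//= in_itv/=; lra.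
Unshelve. all: by end_near. Qed.

Lemma has_derive_in_derive {R : realType} (D : set R) (f : R -> R) (x l : R) :
  limit_point D x -> has_derive_in D f x l -> derive_in D f x = l.
Proof.
by move=> /within_dnbhs_proper ? fl; apply: cvg_lim => //; exact: Rhausdorff.
Qed.

Lemma derivable_in_has {R : realType} (D : set R) (f : R -> R) (x : R) :
  derivable_in D f x -> has_derive_in D f x (derive_in D f x).
Proof. by []. Qed.

(** An epsilon-delta form of the filter that defines [derive_in]; most of what
    follows manipulates it in this form. *)
Lemma within_dnbhs_near {R : realType} (D : set R) (x : R) (P : set R) :
  (\forall y \near within D x^', P y) <->
  exists2 e : R, 0 < e &
    forall y, D y -> y != x -> `|x - y| < e -> P y.
Proof.
split.
- rewrite /prop_near1 /within /= /dnbhs/= => /nbhs_ballP[e /= e0 H].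
  by exists e => // y Dy yx xy; apply: H => //; rewrite -ball_normE.
- move=> [e e0 H]; rewrite /prop_near1 /within /=.
  apply/nbhs_ballP; exists e => //= y; rewrite -ball_normE /= => xy yx Dy.
  exact: H.
Qed.

Lemma within_dnbhs_local {R : realType} (D D' : set R) (x e : R) : 0 < e ->
  (forall y, `|x - y| < e -> D y <-> D' y) -> within D x^' = within D' x^'.
Proof.
move=> e0 DD'; rewrite predeqE => P.
split=> /within_dnbhs_near[d d0 H]; apply/within_dnbhs_near;
  exists (Num.min e d); rewrite ?lt_min ?e0 //;
  move=> y Dy yx; rewrite lt_min => /andP[xye xyd]; apply: H => //.
- by apply/DD'.
- by apply/DD'.
Qed.

Lemma derive_in_local {R : realType} (D D' : set R) (f : R -> R) (x e : R) :
  0 < e -> (forall y, `|x - y| < e -> D y <-> D' y) ->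
  derive_in D f x = derive_in D' f x.
Proof. by move=> e0 /(within_dnbhs_local _ _ _ _ e0); rewrite /derive_in => ->. Qed.

Lemma derivable_in_local {R : realType} (D D' : set R) (f : R -> R) (x e : R) :
  0 < e -> (forall y, `|x - y| < e -> D y <-> D' y) ->
  derivable_in D f x -> derivable_in D' f x.
Proof. by move=> e0 /(within_dnbhs_local _ _ _ _ e0); rewrite /derivable_in => ->. Qed.

Lemma has_derive_in_eq {R : realType} (D : set R) (f g : R -> R) (x l : R) :
  D x -> {in D, f =1 g} -> has_derive_in D f x l -> has_derive_in D g x l.
Proof.
move=> Dx fg; apply: cvg_trans; apply: near_eq_cvg.
apply/within_dnbhs_near; exists 1 => // y Dy _ _.
by rewrite /diff_quot !fg ?inE.
Qed.

Lemma has_derive_inB {R : realType} (D : set R) (f g : R -> R) (x l m : R) :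
  has_derive_in D f x l -> has_derive_in D g x m ->
  has_derive_in D (f \- g) x (l - m).
Proof.
move=> fl gm.
apply: cvg_trans (cvgB fl gm); apply: near_eq_cvg.
apply/within_dnbhs_near; exists 1 => // y _ _ _.
rewrite -[LHS]/(diff_quot f x y - diff_quot g x y) /diff_quot /= -mulrBl.
by congr (_ / _); ring.
Qed.

Lemma has_derive_in_cvg {R : realType} (D : set R) (f : R -> R) (x l : R) :
  has_derive_in D f x l -> f y @[y --> within D x^'] --> f x.
Proof.
move=> fl.
have H : (diff_quot f x y * (y - x) + f x) @[y --> within D x^'] -->
         l * (x - x) + f x.
  apply: cvgD; last exact: cvg_cst.
  apply: cvgM => //; apply: cvgB; last exact: cvg_cst.
  by apply: cvg_within_filter; exact: nbhs_dnbhs.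
rewrite subrr mulr0 add0r in H; apply: cvg_trans H; apply: near_eq_cvg.
apply/within_dnbhs_near; exists 1 => // y _ yx _.
by rewrite /diff_quot divfK ?subr_eq0// subrK.
Qed.

(** As [l != 0], points near [x] other than [x] are not sent to [f x], so the
    difference quotient of the composition splits into a product; the set for
    the outer derivative only has to contain the image. *)
Lemma has_derive_in_comp {R : realType} (D E : set R) (f g : R -> R) (x l m : R) :
  l != 0 -> (forall y, D y -> E (f y)) ->
  has_derive_in D f x l -> has_derive_in E g (f x) m ->
  has_derive_in D (g \o f) x (m * l).
Proof.
move=> l0 DE fl gm.
have fx : forall e : R, 0 < e -> exists2 d : R, 0 < d &
    forall y, D y -> y != x -> `|x - y| < d -> `|f x - f y| < e.
  move=> e e0; have /cvgrPdist_lt/(_ _ e0) := has_derive_in_cvg _ _ _ _ fl.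
  by move=> /within_dnbhs_near.
have [d d0 Hd] : exists2 d : R, 0 < d &
    forall y, D y -> y != x -> `|x - y| < d -> f y != f x.
  have l0' : 0 < `|l| by rewrite normr_gt0.
  have := fl; move=> /cvgrPdist_lt/(_ _ l0') /within_dnbhs_near[d d0 H].
  exists d => // y Dy yx xy; apply: contraTN (H y Dy yx xy) => /eqP fyx.
  by rewrite /diff_quot fyx subrr mul0r subr0 ltxx.
have {}gm : diff_quot g (f x) (f y) @[y --> within D x^'] --> m.
  apply: (cvg_comp f (diff_quot g (f x)) _ gm) => P.
  rewrite /= => /within_dnbhs_near[e e0 He].
  have [d' d'0 Hd'] := fx _ e0.
  apply/within_dnbhs_near; exists (Num.min d d'); rewrite ?lt_min ?d0 //.
  move=> y Dy yx; rewrite lt_min => /andP[xyd xyd']; apply: He.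
  - exact: DE.
  - exact: Hd.
  - exact: Hd'.
apply: cvg_trans (cvgM gm fl); apply: near_eq_cvg.
apply/within_dnbhs_near; exists d => // y Dy yx xy.
have fyx := Hd y Dy yx xy.
rewrite /diff_quot /= mulrA divfK// subr_eq0//.
Qed.

Lemma has_derive_in_id {R : realType} (D : set R) (x : R) :
  has_derive_in D id x 1.
Proof.
have : (1 : R) @[_ --> within D x^'] --> (1 : R) by exact: cvg_cst.
apply: cvg_trans; apply: near_eq_cvg.
apply/within_dnbhs_near; exists 1 => // y Dy yx _.
by rewrite /diff_quot divff// subr_eq0.
Qed.

Lemma has_derive_in_is_derive {R : realType} (D : set R) (f : R -> R) (x l e : R) :
  0 < e -> (forall y, `|x - y| < e -> D y) ->
  has_derive_in D f x l -> is_derive x 1 f l.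
Proof.
move=> e0 De fl.
have H : h^-1 *: ((f \o shift x) (h *: 1) - f x) @[h --> 0^'] --> l.
  have : diff_quot f x (h + x) @[h --> 0^'] --> l.
    apply: (cvg_comp (fun h => h + x) (diff_quot f x) _ fl) => P.
    move=> /within_dnbhs_near[d d0 Hd].
    apply/nbhs_ballP; exists (Num.min e d) => /=; first by rewrite lt_min e0.
    move=> h; rewrite -ball_normE /= sub0r normrN lt_min => /andP[he hd] h0.
    apply: Hd.
    - by apply: De; rewrite opprD addrCA subrr addr0 normrN.
    - by rewrite -subr_eq0 addrK.
    - by rewrite opprD addrCA subrr addr0 normrN.
  apply: cvg_trans; apply: near_eq_cvg; near=> h.
  by rewrite /diff_quot /= addrK scaler1 mulrC.
split; first by apply/cvg_ex; exists l.
by apply: cvg_lim => //; exact: Rhausdorff.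
Unshelve. all: by end_near. Qed.

(** Interior points of the interval see the usual derivative, so the usual mean
    value theorem applies on every subinterval, even one that reaches an endpoint
    of the interval, where only a one-sided derivative exists. *)
Lemma MVT_in {R : realType} (a b : R) (f : R -> R) :
  {within `[a, b], continuous f} ->
  (forall x, `[a, b]%classic x -> derivable_in `[a, b] f x) ->
  forall x y, a <= x -> x < y -> y <= b ->
  exists2 c, x < c < y & f y - f x = derive_in `[a, b] f c * (y - x).
Proof.
move=> fc fd x y ax xy yb.
have H c : c \in `]x, y[ -> is_derive c 1 f (derive_in `[a, b] f c).
  rewrite in_itv /= => /andP[xc cy].
  apply: (has_derive_in_is_derive `[a, b] _ _ _ (Num.min (c - a) (b - c))).
  - rewrite lt_min; lra.
  - move=> z; rewrite lt_min => /andP[]; rewrite !ltr_norml /= in_itv /=.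
    move=> /andP[? ?] /andP[? ?]; lra.
  - apply/derivable_in_has/fd => /=; rewrite in_itv/=; lra.
have [|c] := MVT xy H.
  apply: continuous_subspaceW fc => z /=; rewrite !in_itv /=.
  move=> /andP[? ?]; lra.
by rewrite in_itv /= => cxy E; exists c.
Qed.

Lemma derive_in_le_lipschitz {R : realType} (a b M : R) (f : R -> R) :
  {within `[a, b], continuous f} ->
  (forall x, `[a, b]%classic x -> derivable_in `[a, b] f x) ->
  (forall x, `[a, b]%classic x -> `|derive_in `[a, b] f x| <= M) ->
  forall x y, `[a, b]%classic x -> `[a, b]%classic y ->
  `|f x - f y| <= M * `|x - y|.
Proof.
move=> fc fd fM.
suff H x y : `[a, b]%classic x -> `[a, b]%classic y -> x < y ->
    `|f x - f y| <= M * `|x - y|.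
  move=> x y Dx Dy; have [xy|yx|->] := ltgtP x y; first exact: H.
  - by rewrite distrC (distrC x); exact: H.
  - by rewrite !subrr normr0 mulr0.
rewrite /= !in_itv /= => /andP[ax xb] /andP[ay yb] xy.
have [c /andP[xc cy] E] := MVT_in _ _ _ fc fd _ _ ax xy yb.
rewrite distrC E (distrC x) normrM ler_wpM2r ?fM //= in_itv /=; lra.
Qed.

(** * Bounds by C^k norms *)

(** Continuity on a compact interval is what makes the supremum in [sup_norm] a
    genuine one: [sup] is 0 on unbounded sets. *)
Lemma le_sup_norm {R : realType} (a b : R) (u : R -> R) :
  {within `[a, b], continuous u} ->
  forall x, `[a, b]%classic x -> `|u x| <= sup_norm `[a, b] u.
Proof.
move=> cu x Dx.
have /compact_bounded[M [Mr HM]] := continuous_compact cu (@segment_compact _ a b).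
apply: ub_le_sup; last by exists x.
exists (M + 1) => _ [y Dy <-].
by apply: HM; [rewrite ltrDl | exists y].
Qed.

Lemma le_Ck_norm {R : realType} (a b : R) (k : nat) (u : R -> R) (j : nat) :
  (j <= k)%N -> {within `[a, b], continuous (deriven_in `[a, b] j u)} ->
  forall x, `[a, b]%classic x ->
  `|deriven_in `[a, b] j u x| <= Ck_norm k `[a, b] u.
Proof.
move=> jk cu x Dx; rewrite /Ck_norm.
apply: le_trans (le_sup_norm _ _ _ cu x Dx) _.
have jk1 : (j < k.+1)%N by [].
exact: (le_bigmax _ (fun i : 'I_k.+1 => sup_norm `[a, b] (deriven_in `[a, b] i u))
          (Ordinal jk1)).
Qed.

(** The values of [deriven_in] outside [D] are arbitrary, so the iterated
    derivative of a difference can only be computed on [D]. *)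
Lemma deriven_inB {R : realType} (a b : R) (k : nat) (f g : R -> R) (j : nat) :
  a < b -> Ck_on k `[a, b] f -> Ck_on k `[a, b] g -> (j <= k)%N ->
  {in `[a, b]%classic, deriven_in `[a, b] j (g \- f) =1
    deriven_in `[a, b] j g \- deriven_in `[a, b] j f}.
Proof.
move=> ab [df _] [dg _]; elim: j => [//|j IH] jk x; rewrite inE => Dx.
apply: has_derive_in_derive.
  by apply: limit_point_itv => //; move: Dx; rewrite /= in_itv.
apply: (has_derive_in_eq _ (deriven_in `[a, b] j g \- deriven_in `[a, b] j f)) => //.
  by move=> y Dy; apply/esym/IH => //; exact: ltnW.
apply: has_derive_inB; apply: derivable_in_has; [exact: dg|exact: df].
Qed.

Lemma Ck_norm_dist {R : realType} (a b : R) (k : nat) (f g : R -> R) (j : nat) :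
  a < b -> Ck_on k `[a, b] f -> Ck_on k `[a, b] g -> (j <= k)%N ->
  forall x, `[a, b]%classic x ->
  `|deriven_in `[a, b] j g x - deriven_in `[a, b] j f x|
    <= Ck_norm k `[a, b] (g \- f).
Proof.
move=> ab Cf Cg jk x Dx.
have E := deriven_inB _ _ _ _ _ _ ab Cf Cg jk.
have := E x; rewrite inE => /(_ Dx); rewrite /= => <-.
apply: le_Ck_norm => //.
apply: (subspace_eq_continuous (f := deriven_in `[a, b] j g \- deriven_in `[a, b] j f)).
  by move=> y Dy; rewrite /from_subspace E// inE.
by apply: within_continuousB; [case: Cg => _; exact|case: Cf => _; exact].
Qed.

(** * Uniform expansion near a piecewise expanding unimodal map *)

(** The quantitative features of a piecewise expanding C^2 unimodal map that the
    estimates rely on, with constants that can be kept fixed on a neighbourhood.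
    [lam] bounds the slopes from below; [M] bounds both the slopes and, on each
    side of the critical point, their Lipschitz constant. *)
Record expanding {R : realType} (lam M : R) (g : R -> R) : Prop := Expanding {
  exp_stable : forall x, I x -> I (g x);
  exp_derivable : forall x, I x -> x != 0 -> derivable_in I g x;
  exp_slope : forall x, I x -> x != 0 -> lam <= `|derive_in I g x|;
  exp_lip : forall x y, I x -> I y -> `|g x - g y| <= M * `|x - y|;
  exp_slope_lip : forall x y, I x -> I y -> 0 < x * y ->
    `|derive_in I g x - derive_in I g y| <= M * `|x - y|;
  exp_distortion : forall x y, I x -> I y -> 0 <= x * y -> x != 0 ->
    `|g x - g y| <= (`|derive_in I g x| + M * `|x - y|) * `|x - y| }.

(** Away from 0, the set [I] and the half of [I] containing [x] coincide near
    [x], so the two relative derivatives agree. *)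
Lemma derive_in_I_half {R : realType} (g : R -> R) (x : R) : I x -> x != 0 ->
  let D := if 0 < x then `[0, 1]%classic else `[-1, 0]%classic in
  [/\ D x, derive_in I g x = derive_in D g x &
      derivable_in D g x -> derivable_in I g x].
Proof.
rewrite /I /= in_itv /= => /andP[x1 x2] x0.
have e0 : 0 < `|x| by rewrite normr_gt0.
have H y : `|x - y| < `|x| ->
    ((if 0 < x then `[0, 1]%classic else `[-1, 0]%classic) : set R) y <->
    `[-1, 1]%classic y.
  have [xp|xn] := ltP 0 x; rewrite /= !in_itv /=.
  - by rewrite (gtr0_norm xp) ltr_norml => /andP[? ?]; split=> /andP[? ?]; lra.
  - have xn' : x < 0 by rewrite lt_neqAle x0.
    by rewrite (ltr0_norm xn') ltr_norml => /andP[? ?]; split=> /andP[? ?]; lra.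
split.
- by have [xp|xn] := ltP 0 x; rewrite /= in_itv /=; lra.
- by apply: (derive_in_local _ _ _ _ _ e0) => y /H[? ?].
- by apply: (derivable_in_local _ _ _ _ _ e0) => y /H.
Qed.

Lemma C2_bounds {R : realType} (a b M : R) (g : R -> R) :
  Ck_on 2 `[a, b] g ->
  (forall j, (j <= 2)%N -> forall x, `[a, b]%classic x ->
    `|deriven_in `[a, b] j g x| <= M) ->
  forall x y, `[a, b]%classic x -> `[a, b]%classic y ->
  [/\ `|g x - g y| <= M * `|x - y|,
      `|derive_in `[a, b] g x - derive_in `[a, b] g y| <= M * `|x - y| &
      `|g x - g y| <= (`|derive_in `[a, b] g x| + M * `|x - y|) * `|x - y|].
Proof.
move=> [dg cg] bg x y Dx Dy.
have L : forall x y, `[a, b]%classic x -> `[a, b]%classic y ->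
    `|derive_in `[a, b] g x - derive_in `[a, b] g y| <= M * `|x - y|.
  apply: derive_in_le_lipschitz; [exact: (cg 1%N)|exact: (dg 1%N)|].
  exact: (bg 2%N).
have c0 := cg 0%N isT; have d0 := dg 0%N isT.
have M0 : 0 <= M by apply: le_trans (bg 0%N isT _ Dx).
split.
- by apply: (derive_in_le_lipschitz _ _ _ _ c0 d0 _ _ _ Dx Dy); exact: (bg 1%N).
- exact: L.
- have [<-|nxy] := eqVneq x y; first by rewrite !subrr normr0 !mulr0.
  have [c [Dc cxy E]] : exists c, [/\ `[a, b]%classic c, `|c - x| <= `|x - y| &
      `|g x - g y| = `|derive_in `[a, b] g c| * `|x - y|].
    move: Dx Dy; rewrite /= !in_itv /= => /andP[ax xb] /andP[ay yb].
    have [xy|yx|xy] := ltgtP x y.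
    + have [c /andP[xc cy] E] := MVT_in _ _ _ c0 d0 _ _ ax xy yb.
      exists c; split; first by rewrite in_itv /=; lra.
      * by rewrite gtr0_norm ?ltr0_norm; lra.
      * by rewrite distrC E normrM (distrC x).
    + have [c /andP[xc cy] E] := MVT_in _ _ _ c0 d0 _ _ ay yx xb.
      exists c; split; first by rewrite in_itv /=; lra.
      * by rewrite ltr0_norm ?gtr0_norm; lra.
      * by rewrite E normrM.
    + by rewrite xy eqxx in nxy.
  rewrite E ler_wpM2r// -lerBlDl (le_trans (lerB_dist _ _))//.
  by rewrite (le_trans (L _ _ Dc Dx))// ler_wpM2l.
Qed.

(** The first two derivatives on each half are controlled by the distance
    [B_norm 2 (g \- f)].  Half of the gap [inf |f'| - 1] is given up to let [g]
    vary. *)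
Lemma in_U2_expanding {R : realType} (f : R -> R) : in_U 2 f ->
  exists lam M xi : R, [/\ 1 < lam, 1 <= M, 0 < xi &
    forall g, in_U 2 g -> B_norm 2 (g \- f) < xi ->
      expanding lam M g /\
      (forall x, I x -> `|g x - f x| <= B_norm 2 (g \- f))].
Proof.
move=> [[_ fl fr] _ f1 _ _].
set s := inf _ in f1.
exists ((1 + s) / 2), (Num.max 1 (B_norm 2 f + (s - 1) / 2)), ((s - 1) / 2).
set lam := (1 + s) / 2; set xi := (s - 1) / 2; set M := Num.max _ _.
have sE : s = lam + xi by rewrite /s /lam /xi; lra.
split; [by rewrite /lam; lra|by rewrite le_max lexx|by rewrite /xi; lra|].
move=> g [[_ gl gr] [g1 g2] _ _ gI] gf.
pose halves (D : set R) := D = `[0, 1]%classic \/ D = `[-1, 0]%classic.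
have dist D j x : halves D -> (j <= 2)%N -> D x ->
    `|deriven_in D j g x - deriven_in D j f x| <= B_norm 2 (g \- f).
  rewrite /B_norm le_max => -[->|->] j2 Dx.
  - by rewrite (Ck_norm_dist _ _ 2) ?orbT.
  - by rewrite (Ck_norm_dist _ _ 2)// ltrN10.
have bf D j x : halves D -> (j <= 2)%N -> D x ->
    `|deriven_in D j f x| <= B_norm 2 f.
  rewrite /B_norm le_max => -[->|->] j2 Dx.
  - by rewrite (le_Ck_norm _ _ 2) ?orbT//; case: fr => _; exact.
  - by rewrite (le_Ck_norm _ _ 2)//; case: fl => _; exact.
have bg D j x : halves D -> (j <= 2)%N -> D x -> `|deriven_in D j g x| <= M.
  move=> hD j2 Dx; rewrite /M le_max; apply/orP; right.
  have := dist D j x hD j2 Dx; have := bf D j x hD j2 Dx.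
  have := lerB_dist (deriven_in D j g x) (deriven_in D j f x); lra.
have bounds D x y : halves D -> D x -> D y ->
    [/\ `|g x - g y| <= M * `|x - y|,
      `|derive_in D g x - derive_in D g y| <= M * `|x - y| &
      `|g x - g y| <= (`|derive_in D g x| + M * `|x - y|) * `|x - y|].
  by move=> hD; move: (hD) => -[]E; rewrite E;
    apply: C2_bounds => // j j2 z; rewrite -E; exact: bg.
have halfP (x : R) : halves (if 0 < x then `[0, 1]%classic else `[-1, 0]%classic).
  by rewrite /halves; case: ifP; [left|right].
have same x y : I x -> I y -> 0 <= x * y -> x != 0 ->
    ((if 0 < x then `[0, 1]%classic else `[-1, 0]%classic) : set R) y.
  rewrite /I /= !in_itv /= => Ix Iy xy x0; case: ifPn => [x1|]; rewrite /= in_itv /=.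
  - by move: xy; rewrite pmulr_rge0//; lra.
  - rewrite -leNgt => x1; have x1' : x < 0 by rewrite lt_neqAle x0.
    by move: xy; rewrite nmulr_rge0//; lra.
have lip D x y : halves D -> D x -> D y -> `|g x - g y| <= M * `|x - y|.
  by move=> hD Dx Dy; have [] := bounds D x y hD Dx Dy.
have Mge0 : 0 <= M by rewrite le_max ler01.
split; last first.
  move=> x Ix; have [x0|x0] := leP 0 x.
  - apply: (dist `[0, 1]%classic 0%N) => //; first by left.
    by move: Ix; rewrite /I /= !in_itv /=; lra.
  - apply: (dist `[-1, 0]%classic 0%N) => //; first by right.
    by move: Ix; rewrite /I /= !in_itv /=; lra.
split.
- by move=> x Ix; apply: gI; exists x.
- move=> x Ix x0; have [Dx _] := derive_in_I_half g x Ix x0; apply.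
  move: Dx; case: ifP => _ Dx.
  + by case: gr => /(_ 0%N isT x Dx).
  + by case: gl => /(_ 0%N isT x Dx).
- move=> x Ix x0.
  have [Dx -> _] := derive_in_I_half g x Ix x0.
  have [_ fE _] := derive_in_I_half f x Ix x0.
  have := dist _ 1%N x (halfP x) isT Dx; rewrite /= -fE.
  have : s <= `|derive_in I f x|.
    apply: ge_inf; last by exists x => //; split => // /eqP; exact/negP.
    by exists 0 => _ [? _ <-].
  move: gf; rewrite -/xi => gf.
  have := lerB_dist (derive_in I f x)
    (derive_in (if 0 < x then `[0, 1]%classic else `[-1, 0]%classic) g x).
  rewrite distrC /=; lra.
- move=> x y Ix Iy.
  wlog xy : x y Ix Iy / x <= y.
    move=> H; have [xy|/ltW yx] := leP x y; first exact: H.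
    by rewrite distrC (distrC x); exact: H.
  have I01 (z : R) : I z -> 0 <= z -> `[0, 1]%classic z.
    by rewrite /I /= !in_itv /=; lra.
  have I10 (z : R) : I z -> z <= 0 -> `[-1, 0]%classic z.
    by rewrite /I /= !in_itv /=; lra.
  have [x0|x0] := leP 0 x.
    by apply: (lip `[0, 1]%classic); [left|exact: I01|apply: I01 => //; lra].
  have [y0|y0] := leP y 0.
    by apply: (lip `[-1, 0]%classic); [right|apply: I10 => //; lra|exact: I10].
  have I0 : I (0 : R) by rewrite /I /= in_itv /=; lra.
  have := lip `[-1, 0]%classic x 0 (or_intror erefl)
    (I10 _ Ix (ltW x0)) (I10 _ I0 (lexx 0)).
  have := lip `[0, 1]%classic 0 y (or_introl erefl)
    (I01 _ I0 (lexx 0)) (I01 _ Iy (ltW y0)).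
  have := ler_distD (g 0) (g x) (g y).
  rewrite subr0 sub0r normrN (ltr0_norm x0) (gtr0_norm y0).
  rewrite (@ltr0_norm _ (x - y)); last lra.
  move=> *; have -> : M * - (x - y) = M * - x + M * y by ring.
  lra.
- move=> x y Ix Iy xy.
  have x0 : x != 0 by apply: contraTneq xy => ->; rewrite mul0r ltxx.
  have y0 : y != 0 by apply: contraTneq xy => ->; rewrite mulr0 ltxx.
  have [Dx -> _] := derive_in_I_half g x Ix x0.
  have [_ -> _] := derive_in_I_half g y Iy y0.
  have -> : (0 < y) = (0 < x).
    apply/idP/idP => z0; move: xy; first by rewrite pmulr_lgt0.
    by rewrite pmulr_rgt0.
  by have [] := bounds _ x y (halfP x) Dx (same x y Ix Iy (ltW xy) x0).
- move=> x y Ix Iy xy x0.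
  have [Dx -> _] := derive_in_I_half g x Ix x0.
  by have [] := bounds _ x y (halfP x) Dx (same x y Ix Iy xy x0).
Qed.

(** * Bounded solutions of the twisted cohomological equation *)

Lemma crit_in_I {R : realType} : I (0 : R).
Proof. by rewrite /I /= in_itv /=; lra. Qed.

Lemma bounded_onP {R : realType} (u : R -> R) :
  [bounded u x | x in I] <-> exists A, forall x, I x -> `|u x| <= A.
Proof. exact: (@ex_bound _ _ _ u (globally I) (globally_properfilter crit_in_I)). Qed.

Lemma iter_stable {R : realType} (lam M : R) (g : R -> R) (n : nat) (x : R) :
  expanding lam M g -> I x -> I (iter n g x).
Proof. by move=> eg Ix; elim: n => //= n; exact: exp_stable eg _. Qed.

(** The intermediate points must avoid 0, where [g] need not be differentiable; [g] being
    expanding, the chain rule [has_derive_in_comp] applies at all other points. *)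
Lemma iter_derive_in {R : realType} (lam M : R) (g : R -> R) (n : nat) (x : R) :
  0 < lam -> expanding lam M g -> I x ->
  (forall i, (i < n)%N -> iter i g x != 0) ->
  derive_in I (iter n g) x = \prod_(i < n) derive_in I g (iter i g x).
Proof.
move=> lam0 eg Ix nz.
apply: has_derive_in_derive.
  by apply: limit_point_itv; [lra|move: Ix; rewrite /I /= in_itv].
elim: n nz => [_|n IH nz]; first by rewrite big_ord0; exact: has_derive_in_id.
rewrite big_ord_recr /= mulrC.
apply: (has_derive_in_comp I I (iter n g) g).
- apply/prodf_neq0 => i _; rewrite -normr_gt0 (lt_le_trans lam0)//.
  apply: (exp_slope _ _ _ eg); first exact: (iter_stable _ _ _ _ _ eg).
  by apply: nz; rewrite ltnS ltnW.
- by move=> y; exact: (iter_stable _ _ _ _ _ eg).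
- by apply: IH => i lin; apply: nz; rewrite ltnS ltnW.
- apply/derivable_in_has/(exp_derivable _ _ _ eg); last exact: nz.
  exact: (iter_stable _ _ _ _ _ eg).
Qed.

Lemma tce_solution_bound {R : realType} (lam M S : R) (g v alpha : R -> R) :
  1 < lam -> expanding lam M g -> (forall x, I x -> `|v x| <= S) ->
  tce_solution g v alpha ->
  forall x, I x -> `|alpha x| <= S / (lam - 1).
Proof.
move=> lam1 eg vS [/bounded_onP[A HA] a0 tce].
have S0 : 0 <= S by apply: le_trans (vS 0 crit_in_I).
have lam0 : 0 < lam by lra.
set B := S / (lam - 1).
have B0 : 0 <= B by rewrite divr_ge0//; lra.
have BE : (B + S) / lam = B by rewrite /B; field; rewrite ?gt_eqF//; lra.
(* B is the fixed point of the bound under the equation, and each use of the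
   equation divides the excess over B by lam *)
have H n x : I x -> `|alpha x| <= B + `|A| * lam^-1 ^+ n.
  elim: n x => [|n IH] x Ix.
    by rewrite expr0 mulr1 (le_trans (HA _ Ix))// (le_trans (ler_norm A))// lerDr.
  have [->|x0] := eqVneq x 0.
    by rewrite a0 normr0 addr_ge0// mulr_ge0// exprn_ge0// invr_ge0 ltW.
  have sl := exp_slope _ _ _ eg x Ix x0.
  have p0 : 0 < `|derive_in I g x| by lra.
  have E' : derive_in I g x * alpha x = alpha (g x) - v x.
    by rewrite (tce x Ix x0); ring.
  have : lam * `|alpha x| <= B + `|A| * lam^-1 ^+ n + S.
    apply: le_trans (_ : `|derive_in I g x * alpha x| <= _).
      by rewrite normrM ler_wpM2r.
    rewrite E' (le_trans (ler_normB _ _))// lerD ?vS// IH//.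
    exact: (exp_stable _ _ _ eg).
  rewrite mulrC -ler_pdivlMr// => /le_trans; apply.
  rewrite addrAC mulrDl BE lerD2l exprSr mulrA lexx//.
move=> x Ix; apply/ler_addgt0Pr => e e0.
have lt1 : `|lam^-1| < 1.
  by rewrite ger0_norm ?invr_ge0 ?(ltW lam0)// invf_lt1.
have /cvgrPdist_lt/(_ e e0)[n _ Hn] := cvg_geometric `|A| lt1.
apply: le_trans (H n x Ix) _; rewrite lerD2l.
have := Hn n (leqnn n); rewrite /geometric /= sub0r normrN => /ltW.
exact: le_trans (ler_norm _).
Qed.

Lemma tce_solution_unique {R : realType} (lam M : R) (g v alpha alpha' : R -> R) :
  1 < lam -> expanding lam M g ->
  tce_solution g v alpha -> tce_solution g v alpha' ->
  forall x, I x -> alpha' x = alpha x.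
Proof.
move=> lam1 eg [/bounded_onP[A HA] a0 Ea] [/bounded_onP[B HB] b0 Eb] x Ix.
have S : tce_solution g (fun=> 0) (alpha' \- alpha).
  split.
  - apply/bounded_onP; exists (B + A) => y Iy.
    by rewrite /= (le_trans (ler_normB _ _))// lerD ?HA ?HB.
  - by rewrite /= a0 b0 subrr.
  - move=> y Iy y0 /=; have := Ea y Iy y0; rewrite (Eb y Iy y0).
    move=> /(congr1 (fun t => t - (alpha (g y) - derive_in I g y * alpha y))).
    by rewrite subrr => <-; ring.
have z0 (y : R) : I y -> `|0 : R| <= 0 by rewrite normr0.
have := tce_solution_bound lam M 0 g _ _ lam1 eg z0 S x Ix.
by rewrite mul0r /= normr_le0 subr_eq0 => /eqP.
Qed.

(** The solution is the limit of Picard iterates for the map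
    [a |-> (a o g - v) / g'], which contracts the sup norm by [1 / lam]. *)
Lemma tce_solution_exists {R : realType} (lam M S : R) (g v : R -> R) :
  1 < lam -> expanding lam M g -> (forall x, I x -> `|v x| <= S) ->
  exists alpha, tce_solution g v alpha.
Proof.
move=> lam1 eg vS.
have S0 : 0 <= S by apply: le_trans (vS 0 crit_in_I).
have lam0 : 0 < lam by lra.
pose T (a : R -> R) (x : R) := if x == 0 then 0 else (a (g x) - v x) / derive_in I g x.
pose al n := iter n T (fun=> 0).
set A := S / (lam - 1).
have A0 : 0 <= A by rewrite divr_ge0//; lra.
have AE : (A + S) / lam = A by rewrite /A; field; rewrite ?gt_eqF//; lra.
have slope x : I x -> x != 0 -> `|(derive_in I g x)^-1| <= lam^-1.
  move=> Ix x0; have sl := exp_slope _ _ _ eg x Ix x0.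
  by rewrite normfV lef_pV2 ?posrE//; lra.
have bal n x : I x -> `|al n x| <= A.
  elim: n x => [x Ix|n IH x Ix]; first by rewrite /al /= normr0.
  rewrite /al /= /T; case: eqVneq => [_|x0]; first by rewrite normr0.
  rewrite normrM -AE ler_pM// ?slope//.
  rewrite (le_trans (ler_normB _ _))// lerD ?vS// IH//.
  exact: (exp_stable _ _ _ eg).
have cau n m x : I x -> `|al (n + m)%N x - al n x| <= A * lam^-1 ^+ n.
  elim: n x => [x Ix|n IH x Ix].
    by rewrite add0n /al /= subr0 expr0 mulr1 bal.
  rewrite addSn /al /= /T; case: eqVneq => [_|x0].
    by rewrite subrr normr0 mulr_ge0// exprn_ge0// invr_ge0 ltW.
  rewrite -mulrBl normrM exprSr mulrA ler_pM// ?slope//.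
  have -> t u w : t - w - (u - w) = t - u :> R by ring.
  exact/IH/(exp_stable _ _ _ eg).
have lt1 : `|lam^-1| < 1.
  by rewrite ger0_norm ?invr_ge0 ?(ltW lam0)// invf_lt1.
have cal x : I x -> cvgn (al ^~ x).
  move=> Ix; apply/cauchy_cvgP/cauchy_exP => e e0.
  have /cvgrPdist_lt/(_ e e0)[n _ Hn] := cvg_geometric A lt1.
  exists (al n x); exists n => // m /= nm.
  rewrite -ball_normE /= distrC -(subnKC nm) (le_lt_trans (cau _ _ _ Ix))//.
  have := Hn n (leqnn n); rewrite /geometric /= sub0r normrN.
  exact: le_lt_trans (ler_norm _).
exists (fun x => limn (al ^~ x)); split.
- apply/bounded_onP; exists A => x Ix /=.
  have cx : `|al n x| @[n --> \oo] --> `|limn (al ^~ x)|.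
    by apply: cvg_norm; exact: cal.
  rewrite -(cvg_lim (@Rhausdorff R) cx).
  apply: limr_le; first by apply/cvg_ex; eexists; exact: cx.
  by near=> n; exact: bal.
- have -> : al ^~ 0 = fun=> 0.
    by apply/funext => -[|n] //; rewrite /al /= /T eqxx.
  exact: lim_cst.
- move=> x Ix x0.
  have c1 := cal x Ix.
  have c2 : al n (g x) @[n --> \oo] --> limn (al ^~ (g x)).
    exact/cal/(exp_stable _ _ _ eg).
  have c3 : (al n (g x) - v x) / derive_in I g x @[n --> \oo] --> 
            (limn (al ^~ (g x)) - v x) / derive_in I g x.
    apply: cvgM; last exact: cvg_cst.
    by apply: cvgB => //; exact: cvg_cst.
  have c4 : al n.+1 x @[n --> \oo] --> limn (al ^~ x).
    by rewrite (cvg_shiftS (al ^~ x)).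
  have c5 : (al n (g x) - v x) / derive_in I g x @[n --> \oo] --> limn (al ^~ x).
    move: c4; rewrite /al /= /T; case: eqP => // x0'.
    by rewrite x0' eqxx in x0.
  have sl := exp_slope _ _ _ eg x Ix x0.
  have p0 : derive_in I g x != 0 by rewrite -normr_gt0; lra.
  rewrite -(cvg_unique (@Rhausdorff R) c3 c5).
  by field.
Unshelve. all: by end_near. Qed.

(** * The functional J *)

Lemma prod_slope_ge {R : realType} (lam M : R) (g : R -> R) (n : nat) (x : R) :
  0 < lam -> expanding lam M g -> I x ->
  (forall i, (i < n)%N -> iter i g x != 0) ->
  lam ^+ n <= `|\prod_(i < n) derive_in I g (iter i g x)|.
Proof.
move=> lam0 eg Ix; elim: n => [_|n IH nz]; first by rewrite big_ord0 normr1.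
rewrite big_ord_recr /= normrM exprSr ler_pM ?(ltW lam0) ?exprn_ge0 ?IH//.
- exact: ltW.
- by move=> i lin; apply: nz; rewrite ltnS ltnW.
- by apply: (exp_slope _ _ _ eg); [exact: (iter_stable _ _ _ _ _ eg)|exact: nz].
Qed.

(** By the equation at [x = g^j 0], the [j]-th term is
    [alpha (g^(j+1) 0) / (g^j)' - alpha (g^j 0) / (g^(j-1))'] for [j > 0]. *)
Lemma series_telescope {R : realType} (lam M : R) (g v alpha : R -> R) (n : nat) :
  0 < lam -> expanding lam M g -> tce_solution g v alpha ->
  (forall i, (0 < i < n.+1)%N -> crit_orbit g i != 0) ->
  \sum_(0 <= j < n.+1)
     v (crit_orbit g j) / derive_in I (iter j g) (crit_orbit g 1) =
  v 0 - alpha (g 0) +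
  alpha (crit_orbit g n.+1) / \prod_(i < n) derive_in I g (iter i g (g 0)).
Proof.
move=> lam0 eg [_ _ tce].
have Ig0 : I (g 0) := exp_stable _ _ _ eg _ crit_in_I.
have step k : (forall i, (0 < i < k.+1)%N -> crit_orbit g i != 0) ->
    forall i, (i < k)%N -> iter i g (g 0) != 0.
  by move=> nz i ik; rewrite -iterSr; exact: (nz i.+1).
elim: n => [_|n IH nz].
  rewrite big_nat1 big_ord0 (iter_derive_in _ _ _ 0 _ lam0 eg Ig0)// big_ord0.
  by rewrite !divr1 /crit_orbit /=; ring.
rewrite big_nat_recr //= IH; last first.
  by move=> i /andP[i0 i1]; apply: nz; rewrite i0 ltnS ltnW.
rewrite (iter_derive_in _ _ _ n.+1 _ lam0 eg Ig0); last exact: step.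
have cn0 : crit_orbit g n.+1 != 0 by apply: nz; rewrite /= ltnSn.
have Icn : I (crit_orbit g n.+1) by exact: (iter_stable _ _ _ _ _ eg crit_in_I).
rewrite -addrA; congr (_ + _).
rewrite big_ord_recr /= (tce _ Icn cn0).
have -> : iter n g (g 0) = crit_orbit g n.+1 by rewrite -iterSr.
have P0 : \prod_(i < n) derive_in I g (iter i g (g 0)) != 0.
  rewrite -normr_gt0 (lt_le_trans _ (prod_slope_ge _ _ _ _ _ lam0 eg Ig0 _))//.
    exact: exprn_gt0.
  by move=> i lin; apply: (step _ nz); rewrite ltnS ltnW.
have Q0 : derive_in I g (crit_orbit g n.+1) != 0.
  by rewrite -normr_gt0 (lt_le_trans lam0)// (exp_slope _ _ _ eg).
rewrite /crit_orbit /= in Q0 *.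
by field; rewrite Q0.
Qed.

(** In the telescoped sum the remainder vanishes: for a critical point of period
    [q] because [alpha (g^q 0) = alpha 0 = 0], otherwise in the limit because
    [alpha] is bounded and the slopes of the iterates grow exponentially. *)
Lemma J_eq {R : realType} (lam M : R) (g v alpha : R -> R) :
  1 < lam -> expanding lam M g -> tce_solution g v alpha ->
  J g v = v 0 - alpha (g 0).
Proof.
move=> lam1 eg sol; have lam0 : 0 < lam by lra.
have [/bounded_onP[A HA] a0 tce] := sol.
have Ig0 : I (g 0) := exp_stable _ _ _ eg _ crit_in_I.
rewrite /J /crit_period; case: pselect => [per|nper].
  case: ex_minnP => q /andP[]; case: q => // q _ /eqP cq qmin.
  rewrite (series_telescope _ _ _ _ alpha _ lam0 eg)//.
    by rewrite cq a0 mul0r addr0.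
  move=> i /andP[i0 iq]; apply/negP => ci.
  by have := qmin i; rewrite i0 ci /= => /(_ isT); rewrite leqNgt iq.
have nz i : (0 < i)%N -> crit_orbit g i != 0.
  by move=> i0; apply/negP => ci; apply: nper; exists i; rewrite i0.
have nz' i : iter i g (g 0) != 0 by rewrite -iterSr; exact: (nz i.+1).
apply: cvg_lim; first exact: Rhausdorff.
set u := (X in series X).
rewrite -cvg_shiftS /=.
pose r n := alpha (crit_orbit g n.+1) / \prod_(i < n) derive_in I g (iter i g (g 0)).
have -> : (fun n => series u n.+1) = (fun n => v 0 - alpha (g 0) + r n).
  apply/funext => n; rewrite seriesEnat /= /u.
  rewrite (series_telescope _ _ _ _ alpha _ lam0 eg)//.
  by move=> i /andP[i0 _]; exact: nz.
suff r0 : r n @[n --> \oo] --> (0 : R).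
  have : v 0 - alpha (g 0) + r n @[n --> \oo] --> v 0 - alpha (g 0) + 0.
    by apply: cvgD => //; exact: cvg_cst.
  by rewrite addr0.
apply/cvgrPdist_lt => e e0.
have lt1 : `|lam^-1| < 1.
  by rewrite ger0_norm ?invr_ge0 ?(ltW lam0)// invf_lt1.
have /cvgrPdist_lt/(_ e e0)[n _ Hn] := cvg_geometric A lt1.
exists n => // m nm; have := Hn m nm; rewrite /geometric /= !sub0r !normrN.
apply: le_lt_trans; apply: le_trans (ler_norm _).
rewrite /r normrM normfV exprVn ler_pM ?invr_ge0//.
  by apply: HA; exact: (iter_stable _ _ _ _ _ eg crit_in_I).
rewrite lef_pV2 ?posrE ?exprn_gt0//.
  exact: (prod_slope_ge _ _ _ _ _ lam0 eg Ig0).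
rewrite (lt_le_trans _ (prod_slope_ge _ _ _ _ _ lam0 eg Ig0 _))// exprn_gt0//.
Qed.

(** * Contraction of Hoelder bounds at small scales *)

(** The additive error [E] is there because the function to be estimated is a
    priori only bounded. *)
Definition holder_below {R : realType} (beta B E : R) (alpha : R -> R)
    (x y : R) : Prop :=
  `|alpha x - alpha y| <= B * `|x - y| `^ beta + E.

(** At scales below [delta], the factor [1 + M * delta] bounds the distortion of
    slopes, and [kappa] is the resulting rate of contraction of Hoelder
    constants of exponent [beta]. *)
Record contraction {R : realType} (lam M beta kappa delta : R) : Prop := Contraction {
  ctr_lam : 1 < lam;
  ctr_M : 1 <= M;
  ctr_beta0 : 0 < beta;
  ctr_beta1 : beta < 1;
  ctr_delta0 : 0 < delta;
  ctr_delta1 : delta <= 1;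
  ctr_kappa : (1 + M * delta) * lam `^ (beta - 1) <= kappa;
  ctr_kappa1 : kappa < 1 }.

(** [ctce_crit] extends the equation to the critical point, for whatever slope is
    assigned to [g] there, since [alpha 0 = 0]. *)
Record continuous_tce {R : realType} (beta Nv A : R) (g v alpha : R -> R) : Prop :=
    ContinuousTce {
  ctce_v : forall x y, I x -> I y -> `|v x - v y| <= Nv * `|x - y| `^ beta;
  ctce_bound : forall x, I x -> `|alpha x| <= A;
  ctce_0 : alpha 0 = 0;
  ctce_crit : v 0 = alpha (g 0);
  ctce_eq : forall x, I x -> x != 0 ->
    v x = alpha (g x) - derive_in I g x * alpha x }.

Section Contraction.
Context {R : realType} {lam M beta kappa delta : R}.
Hypothesis ctr : contraction lam M beta kappa delta.

Lemma kappa_gt0 : 0 < kappa.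
Proof.
have [lam1 M1 beta0 beta1 delta0 delta1 kappa_ge kappa1] := ctr.
have lam0 : 0 < lam by lra.
have Md : 0 <= M * delta by apply: mulr_ge0; lra.
apply: lt_le_trans kappa_ge; rewrite mulr_gt0 ?powR_gt0//.
lra.
Qed.

Lemma kappa_ge_invlam : lam^-1 <= kappa.
Proof.
have [lam1 M1 beta0 beta1 delta0 delta1 kappa_ge kappa1] := ctr.
have lam0 : 0 < lam by lra.
have Md : 0 <= M * delta by apply: mulr_ge0; lra.
apply: le_trans kappa_ge; rewrite -[leLHS]mul1r; apply: ler_pM => //.
- by rewrite invr_ge0 ltW.
- by rewrite lerDl.
- rewrite -powR_inv1 ?(ltW lam0)//; apply: ler_powR; first exact: ltW.
  by rewrite lerBDl subrr ltW.
Qed.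

(** With [p = |g' x|] and [d = |x - y|], bounded distortion gives
    [|g x - g y| <= p * (1 + M * delta) * d], and [p^beta / p <= lam^(beta - 1)]
    as [beta < 1]. *)
Lemma image_pow_contracts (g : R -> R) x y : expanding lam M g ->
  I x -> I y -> 0 <= x * y -> x != 0 ->
  `|x - y| <= delta ->
  `|g x - g y| `^ beta / `|derive_in I g x| <= kappa * `|x - y| `^ beta.
Proof.
have [lam1 M1 beta0 beta1 delta0 delta1 kappa_ge kappa1] := ctr.
have lam0 : 0 < lam by lra.
have Md : 0 <= M * delta by apply: mulr_ge0; lra.
move=> eg Ix Iy xy x0 xyd.
have sl := exp_slope _ _ _ eg x Ix x0.
set p := `|derive_in I g x| in sl *; set d := `|x - y| in xyd *.
have p0 : 0 < p by lra.
have d0 : 0 <= d := normr_ge0 _.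
have gd : `|g x - g y| <= p * ((1 + M * delta) * d).
  apply: le_trans (exp_distortion _ _ _ eg x y Ix Iy xy x0) _.
  rewrite -/p -/d mulrA ler_wpM2r// mulrDr mulr1 lerD2l.
  apply: le_trans (_ : M * delta <= _); first by rewrite ler_wpM2l//; lra.
  by rewrite -[leLHS]mul1r ler_wpM2r//; lra.
rewrite ler_pdivrMr//.
apply: le_trans (_ : (p * ((1 + M * delta) * d)) `^ beta <= _).
  apply: ge0_ler_powR => //; rewrite ?nnegrE ?normr_ge0 ?(ltW beta0)//.
  by rewrite !mulr_ge0// ?(ltW p0)// addr_ge0.
rewrite !powRM ?mulr_ge0 ?addr_ge0 ?(ltW p0)//.
have -> : p `^ beta = p `^ (beta - 1) * p.
  rewrite -{3}[p](powRr1) ?(ltW p0)// -powRD ?subrK//.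
  by rewrite (gt_eqF p0) implybT.
rewrite [leLHS](_ : _ =
  (1 + M * delta) `^ beta * p `^ (beta - 1) * d `^ beta * p); last by ring.
rewrite ler_wpM2r ?(ltW p0)// ler_wpM2r ?powR_ge0//.
apply: le_trans kappa_ge; rewrite ler_pM ?powR_ge0//.
  by apply: ler1_powR; [rewrite lerDl|exact: ltW].
have -> : beta - 1 = - (1 - beta) by ring.
rewrite !powRN lef_pV2 ?posrE ?powR_gt0//.
apply: ge0_ler_powR; rewrite ?nnegrE; lra.
Qed.

End Contraction.

Section Pullback.
Context {R : realType} {lam M beta kappa delta Nv A : R} {g v alpha : R -> R}.
Hypotheses (ctr : contraction lam M beta kappa delta) (eg : expanding lam M g)
  (sol : continuous_tce beta Nv A g v alpha).

(** One step of the estimate: a Hoelder bound for the images is pulled back with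
    a better constant [kappa * B] and error [kappa * E], up to the source term
    [K], which collects the variation of [v] and that of the slopes.  One of the
    points may be the critical point thanks to [v 0 = alpha (g 0)]. *)
Lemma pullback x y B E : let K := Nv + M * A in
  I x -> I y -> 0 <= x * y -> `|x - y| <= delta ->
  0 <= B -> 0 <= E ->
  holder_below beta B E alpha (g x) (g y) ->
  holder_below beta (kappa * B + K) (kappa * E) alpha x y.
Proof.
have [lam1 M1 beta0 beta1 delta0 delta1 kappa_ge kappa1] := ctr.
have lam0 : 0 < lam by lra.
have Md : 0 <= M * delta by apply: mulr_ge0; lra.
have [vN aA a0 v0 tce] := sol.
have A0 : 0 <= A := le_trans (normr_ge0 _) (aA _ crit_in_I).
move=> K Ix Iy xy xyd B0 E0; have KE : K = Nv + M * A by [].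
have KN0 : 0 <= K.
  have := vN 1 (-1); rewrite KE => H.
  suff : 0 <= Nv by move=> ?; rewrite addr_ge0// mulr_ge0//; lra.
  have I1 : I (1 : R) by rewrite /I /= in_itv /=; lra.
  have I1' : I (-1 : R) by rewrite /I /= in_itv /=; lra.
  have := le_trans (normr_ge0 _) (H I1 I1').
  by rewrite pmulr_lge0// powR_gt0// normr_gt0; lra.
have k0 := kappa_gt0 ctr.
have [->|nxy] := eqVneq x y.
  move=> _; rewrite /holder_below !subrr normr0.
  have c0 : 0 <= kappa * B by apply: mulr_ge0 => //; exact: ltW.
  have e0 : 0 <= kappa * E by apply: mulr_ge0 => //; exact: ltW.
  have c1 : 0 <= kappa * B + K by exact: addr_ge0.
  by apply: addr_ge0 => //; apply: mulr_ge0 => //; exact: powR_ge0.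
(* the slope to divide by has to be taken at a point other than 0 *)
wlog x0 : x y Ix Iy xy xyd nxy / x != 0.
  move=> H; have [x0|x0] := eqVneq x 0; last exact: H.
  have y0 : y != 0 by rewrite -x0 eq_sym.
  move=> Hg; rewrite /holder_below distrC (distrC x).
  apply: H => //; [by rewrite mulrC|by rewrite distrC|by rewrite eq_sym|].
  by rewrite /holder_below distrC (distrC (g y)).
rewrite /holder_below => Hg.
have sl := exp_slope _ _ _ eg x Ix x0.
set G := derive_in I g x in sl *.
have p0 : 0 < `|G| by lra.
set d := `|x - y| in xyd Hg *.
have d0 : 0 < d by rewrite normr_gt0 subr_eq0.
have dd : d <= d `^ beta by rewrite ger1_powR ?d0//=; lra.
have key : `|G| * `|alpha x - alpha y| <=
   `|alpha (g x) - alpha (g y)| + K * d `^ beta.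
  have Gx : G * alpha x = alpha (g x) - v x by rewrite (tce x Ix x0) -/G; ring.
  rewrite -normrM mulrBr Gx.
  have [y0|y0] := eqVneq y 0.
    rewrite y0 a0 mulr0 subr0.
    have -> : alpha (g x) - v x = (alpha (g x) - alpha (g 0)) - (v x - v 0).
      by rewrite v0; ring.
    rewrite (le_trans (ler_normB _ _))// lerD2l.
    apply: le_trans (vN _ _ Ix crit_in_I) _; rewrite -y0 ler_wpM2r ?powR_ge0//.
    by rewrite KE lerDl mulr_ge0//; lra.
  have Gy : derive_in I g y * alpha y = alpha (g y) - v y.
    by rewrite (tce y Iy y0); ring.
  have -> : alpha (g x) - v x - G * alpha y =
    (alpha (g x) - alpha (g y)) - ((v x - v y) + (G - derive_in I g y) * alpha y).
    by rewrite mulrBl Gy; ring.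
  rewrite (le_trans (ler_normB _ _))// lerD2l.
  have -> : K * d `^ beta = Nv * d `^ beta + M * A * d `^ beta.
    by rewrite KE mulrDl.
  rewrite (le_trans (ler_normD _ _))// lerD ?vN//.
  rewrite normrM [leRHS]mulrAC ler_pM//; last exact: aA.
  apply: le_trans (exp_slope_lip _ _ _ eg x y Ix Iy _) _.
    by rewrite lt_neqAle xy andbT eq_sym mulf_neq0.
  by apply: ler_wpM2l => //; lra.
have {key} : `|G| * `|alpha x - alpha y| <=
   B * `|g x - g y| `^ beta + E + K * d `^ beta.
  by apply: le_trans key _; rewrite lerD2r.
rewrite mulrC -ler_pdivlMr// => /le_trans; apply.
have H1 := image_pow_contracts ctr g x y eg Ix Iy xy x0 xyd.
have H2 : `|G|^-1 <= kappa.
  by apply: le_trans (kappa_ge_invlam ctr); rewrite lef_pV2 ?posrE.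
have H3 : `|G|^-1 <= 1 by rewrite invf_le1; lra.
have {H1} T1 := ler_wpM2l B0 H1.
have {H2} T2 := ler_wpM2l E0 H2.
have Kd : 0 <= K * d `^ beta by rewrite mulr_ge0// powR_ge0.
have {H3} T3 := ler_wpM2l Kd H3.
rewrite -/G -/d in T1.
rewrite [leLHS](_ : _ = B * (`|g x - g y| `^ beta / `|G|) + E / `|G| +
  K * d `^ beta / `|G|); last by ring.
rewrite [leRHS](_ : _ = B * (kappa * d `^ beta) + E * kappa +
  K * d `^ beta * 1); last by ring.
by rewrite !lerD.
Qed.
End Pullback.

(** * From bounded to Hoelder solutions *)

Lemma holder_below_le {R : realType} (beta B B' E E' : R) (alpha : R -> R) (x y : R) :
  B <= B' -> E <= E' ->
  holder_below beta B E alpha x y -> holder_below beta B' E' alpha x y.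
Proof.
rewrite /holder_below => BB EE /le_trans; apply.
by apply: lerD => //; rewrite ler_wpM2r// powR_ge0.
Qed.

Lemma iter_lip {R : realType} (lam M : R) (g : R -> R) (n : nat) (x y : R) :
  0 <= M -> expanding lam M g -> I x -> I y ->
  `|iter n g x - iter n g y| <= M ^+ n * `|x - y|.
Proof.
move=> M0 eg Ix Iy; elim: n => [|n IH]; first by rewrite expr0 mul1r.
apply: le_trans (exp_lip _ _ _ eg _ _ (iter_stable _ _ _ _ _ eg Ix)
  (iter_stable _ _ _ _ _ eg Iy)) _.
by rewrite exprS -mulrA ler_wpM2l.
Qed.

(** The sum of the geometric series of source terms [Nv + M * A] picked up along
    repeated applications of [pullback]. *)
Definition pullback_const {R : realType} (M kappa Nv A : R) : R :=
  (Nv + M * A) / (1 - kappa).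

Section HolderEstimate.
Context {R : realType} {lam M beta kappa delta Nv A eta rho : R} {N : nat}
  {g v alpha : R -> R}.
Hypotheses (ctr : contraction lam M beta kappa delta) (eg : expanding lam M g)
  (sol : continuous_tce beta Nv A g v alpha)
  (kN : 2 * kappa ^+ N <= 2^-1)
  (crit : forall j, (j <= N)%N -> iter j g 0 = 0 \/ eta <= `|iter j g 0|)
  (rho0 : 0 < rho) (rho_delta : M ^+ (N + N) * rho <= delta)
  (rho_eta : M ^+ (N + N) * rho <= eta).

Local Notation K := (pullback_const M kappa Nv A).

Lemma pullback_const_ge0 : 0 <= K.
Proof.
have [lam1 M1 beta0 beta1 delta0 delta1 kappa_ge kappa1] := ctr.
have [vN aA a0 v0 tce] := sol.
have A0 : 0 <= A := le_trans (normr_ge0 _) (aA _ crit_in_I).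
have I1 : I (1 : R) by rewrite /I /= in_itv /=; lra.
have I1' : I (-1 : R) by rewrite /I /= in_itv /=; lra.
have Nv0 : 0 <= Nv.
  have := le_trans (normr_ge0 _) (vN _ _ I1 I1').
  by rewrite pmulr_lge0// powR_gt0// normr_gt0; lra.
apply: divr_ge0; last lra.
by apply: addr_ge0 => //; apply: mulr_ge0 => //; lra.
Qed.

Lemma pullback_iter n x y B E : I x -> I y ->
  (forall j, (j < n)%N -> 0 <= iter j g x * iter j g y) ->
  (forall j, (j < n)%N -> `|iter j g x - iter j g y| <= delta) ->
  0 <= B -> 0 <= E ->
  holder_below beta B E alpha (iter n g x) (iter n g y) ->
  holder_below beta (kappa ^+ n * B + K) (kappa ^+ n * E) alpha x y.
Proof.
have k0 := kappa_gt0 ctr; have k1 := ctr_kappa1 _ _ _ _ _ ctr.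
have K0 := pullback_const_ge0.
elim: n x y => [|n IH] x y Ix Iy same close B0 E0.
  apply: holder_below_le; rewrite expr0 mul1r ?lerDl//.
rewrite !iterSr => H.
have {H} H := IH _ _ (exp_stable _ _ _ eg _ Ix) (exp_stable _ _ _ eg _ Iy)
  _ _ B0 E0 H.
have kn : 0 <= kappa ^+ n by rewrite exprn_ge0// ltW.
have -> : kappa ^+ n.+1 * B + K = kappa * (kappa ^+ n * B + K) + (Nv + M * A).
  by rewrite /pullback_const exprS; field; lra.
rewrite exprS -mulrA.
apply: (pullback ctr eg sol) => //.
- exact: (same 0%N).
- exact: (close 0%N).
- by apply: addr_ge0 => //; exact: mulr_ge0.
- exact: mulr_ge0.
- by apply: H => j jn; rewrite -!iterSr; [exact: same|exact: close].
Qed.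

(** Either [g^j 0] is at distance at least [eta] from 0, and [g^j z] is within
    [eta] of it, or [g^j 0 = 0] and there is nothing to check.  The second case
    covers periodic critical points. *)
Lemma near_crit_same_side z j : I z -> `|z| <= M ^+ N * rho -> (j <= N)%N ->
  0 <= iter j g 0 * iter j g z.
Proof.
move=> Iz zr jN.
have M1 := ctr_M _ _ _ _ _ ctr.
have M0 : 0 <= M by lra.
have [->|cj] := crit _ jN; first by rewrite mul0r.
have d : `|iter j g 0 - iter j g z| <= eta.
  apply: le_trans (iter_lip _ _ _ _ _ _ M0 eg crit_in_I Iz) _.
  apply: le_trans rho_eta; rewrite sub0r normrN exprD -mulrA.
  by apply: ler_pM => //; [rewrite exprn_ge0|apply: ler_weXn2l].
set a := iter j g 0 in cj d *; set b := iter j g z in d *.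
have {d cj} := le_trans d cj.
have [a0|a0] := leP 0 a.
  rewrite (ger0_norm a0) ler_norml => /andP[? ?].
  by apply: mulr_ge0 => //; lra.
rewrite (ltr0_norm a0) ler_norml => /andP[? ?].
by apply: mulr_le0; lra.
Qed.

(** A short interval with 0 as endpoint is not cut by 0 during [N] steps, so here
    [N] contractions come for free. *)
Lemma holder_from_crit z B E : I z -> `|z| <= M ^+ N * rho ->
  0 <= B -> 0 <= E ->
  (forall x y, I x -> I y -> holder_below beta B E alpha x y) ->
  holder_below beta (kappa ^+ N * B + K) (kappa ^+ N * E) alpha 0 z.
Proof.
move=> Iz zr B0 E0 H.
have M1 := ctr_M _ _ _ _ _ ctr.
have M0 : 0 <= M by lra.
apply: pullback_iter => //; first exact: crit_in_I.
- by move=> j jN; apply: near_crit_same_side => //; exact: ltnW.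
- move=> j jN; apply: le_trans (iter_lip _ _ _ _ _ _ M0 eg crit_in_I Iz) _.
  apply: le_trans rho_delta; rewrite sub0r normrN exprD -mulrA.
  by apply: ler_pM => //; [rewrite exprn_ge0|apply: ler_weXn2l => //; exact: ltnW].
- by apply: H; apply: (iter_stable _ _ _ _ _ eg) => //; exact: crit_in_I.
Qed.

(** If 0 never separates the two orbits before time [N], [N] contractions apply.
    Otherwise let [k] be the first time it does: the distance of [g^k x] to
    [g^k y] is split at 0, each half enjoys [N] contractions by
    [holder_from_crit], and the first [k] steps are then pulled back. *)
Lemma holder_block x y B E : I x -> I y -> `|x - y| <= rho ->
  0 <= B -> 0 <= E ->
  (forall x y, I x -> I y -> holder_below beta B E alpha x y) ->
  holder_below beta (2 * kappa ^+ N * B + 3 * K) (2 * kappa ^+ N * E) alpha x y.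
Proof.
move=> Ix Iy xyr B0 E0 H.
have [lam1 M1 beta0 beta1 delta0 delta1 kappa_ge kappa1] := ctr.
have M0 : 0 <= M by lra.
have k0 := kappa_gt0 ctr; have K0 := pullback_const_ge0.
have kN0 : 0 <= kappa ^+ N by rewrite exprn_ge0// ltW.
have kB := mulr_ge0 kN0 B0; have kE := mulr_ge0 kN0 E0.
have close j : (j <= N)%N -> `|iter j g x - iter j g y| <= M ^+ N * rho.
  move=> jN; apply: le_trans (iter_lip _ _ _ _ _ _ M0 eg Ix Iy) _.
  by apply: ler_pM => //; [rewrite exprn_ge0|apply: ler_weXn2l].
have close' j : (j <= N)%N -> `|iter j g x - iter j g y| <= delta.
  move=> /close/le_trans; apply; apply: le_trans rho_delta.
  apply: ler_wpM2r; first exact: ltW.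
  by apply: ler_weXn2l => //; exact: leq_addr.
have [/existsP[i xi]|nocross] :=
    boolP [exists i : 'I_N, iter i g x * iter i g y < 0]; last first.
  apply: (holder_below_le _ (kappa ^+ N * B + K) _ (kappa ^+ N * E)); try lra.
  apply: pullback_iter => //.
  - move=> j jN; rewrite leNgt; apply: contra nocross => xj.
    by apply/existsP; exists (Ordinal jN).
  - by move=> j jN; apply: close'; exact: ltnW.
  - by apply: H; exact: (iter_stable _ _ _ _ _ eg).
have ex : exists k, (k < N)%N && (iter k g x * iter k g y < 0).
  by exists i; rewrite ltn_ord.
case: (ex_minnP ex) => k /andP[kN' xk] kmin {i xi ex}.
have kk0 : 0 <= kappa ^+ k by rewrite exprn_ge0// ltW.
have kk1 : kappa ^+ k <= 1 by apply: exprn_ile1; rewrite ltW.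
set C := 2 * kappa ^+ N * B + 2 * K; set F := 2 * kappa ^+ N * E.
have C0 : 0 <= C by rewrite /C; lra.
have F0 : 0 <= F by rewrite /F; lra.
apply: (holder_below_le _ (kappa ^+ k * C + K) _ (kappa ^+ k * F)).
- have := ler_wpM2r C0 kk1; rewrite /C; lra.
- have := ler_wpM2r F0 kk1; rewrite /F; lra.
apply: pullback_iter => //.
- move=> j jk; rewrite leNgt; apply/negP => xj.
  have := kmin j; rewrite (ltn_trans jk kN') xj => /(_ isT).
  by rewrite leqNgt jk.
- by move=> j jk; apply: close'; rewrite ltnW// (ltn_trans jk).
have Ip := iter_stable _ _ _ k _ eg Ix; have Iq := iter_stable _ _ _ k _ eg Iy.
have pq := close k (ltnW kN').
set p := iter k g x in xk pq Ip *; set q := iter k g y in xk pq Iq *.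
(* p and q lie on opposite sides of 0, hence both are closer to 0 than to
   each other *)
have [hp hq] : `|p| <= `|p - q| /\ `|q| <= `|p - q|.
  have [p0|p0|p0] := ltgtP p 0; last by move: xk; rewrite p0 mul0r ltxx.
  - move: xk; rewrite nmulr_rlt0// => q0.
    by rewrite (ltr0_norm p0) (gtr0_norm q0) (@ltr0_norm _ (p - q)); [split|]; lra.
  - move: xk; rewrite pmulr_rlt0// => q0.
    by rewrite (gtr0_norm p0) (ltr0_norm q0) (@gtr0_norm _ (p - q)); [split|]; lra.
have Hp := holder_from_crit p B E Ip (le_trans hp pq) B0 E0 H.
have Hq := holder_from_crit q B E Iq (le_trans hq pq) B0 E0 H.
move: Hp Hq; rewrite /holder_below !sub0r !normrN => Hp Hq.
have powle (z : R) : `|z| <= `|p - q| -> `|z| `^ beta <= `|p - q| `^ beta.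
  by move=> zpq; apply: ge0_ler_powR; rewrite ?nnegrE ?(ltW beta0).
have kBK : 0 <= kappa ^+ N * B + K by lra.
have P1 := ler_wpM2l kBK (powle _ hp).
have P2 := ler_wpM2l kBK (powle _ hq).
have := ler_distD (alpha 0) (alpha p) (alpha q).
rewrite (distrC (alpha p) (alpha 0)).
rewrite /C /F [X in _ -> _ <= X * _ + _](_ : _ = 2 * (kappa ^+ N * B + K)); last by ring.
lra.
Qed.

(** By induction on [n] the bound holds with error [2 * A / 2^n].  Pairs further
    apart than [rho] satisfy it since [|alpha| <= A], which explains the summand
    [2 * A / rho^beta]; for closer pairs, [holder_block] turns [B] into at most
    [B / 2 + 3 * K <= B]. *)
Lemma holder_of_tce x y : I x -> I y ->
  `|alpha x - alpha y| <= (6 * K + 2 * A / rho `^ beta) * `|x - y| `^ beta.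
Proof.
have [lam1 M1 beta0 beta1 delta0 delta1 kappa_ge kappa1] := ctr.
have [vN aA a0 v0 tce] := sol.
have A0 : 0 <= A := le_trans (normr_ge0 _) (aA _ crit_in_I).
have k0 := kappa_gt0 ctr; have K0 := pullback_const_ge0.
have r0 : 0 < rho `^ beta by exact: powR_gt0.
have A20 : 0 <= 2 * A / rho `^ beta by apply: divr_ge0; [lra|exact: ltW].
set B := 6 * K + 2 * A / rho `^ beta.
have KB : 6 * K <= B by rewrite /B; lra.
have B0 : 0 <= B by lra.
have H n : forall x y, I x -> I y ->
    holder_below beta B (2 * A * 2^-1 ^+ n) alpha x y.
  elim: n => [|n IH] {}x {}y Ix Iy.
    rewrite /holder_below expr0 mulr1.
    have Bd : 0 <= B * `|x - y| `^ beta by apply: mulr_ge0; rewrite ?powR_ge0.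
    have := aA x Ix; have := aA y Iy; have := ler_normB (alpha x) (alpha y); lra.
  have E0 : 0 <= 2 * A * 2^-1 ^+ n.
    by apply: mulr_ge0; [lra|apply: exprn_ge0; lra].
  have [xyr|xyr] := leP `|x - y| rho.
    apply: holder_below_le (holder_block x y B _ Ix Iy xyr B0 E0 IH).
    - have := ler_wpM2r B0 kN; lra.
    - have := ler_wpM2r E0 kN; rewrite exprS; lra.
  rewrite /holder_below; apply: le_trans (_ : 2 * A <= _).
    have := aA x Ix; have := aA y Iy; have := ler_normB (alpha x) (alpha y); lra.
  have d : rho `^ beta <= `|x - y| `^ beta.
    by apply: ge0_ler_powR; rewrite ?nnegrE ?(ltW beta0) ?(ltW rho0) ?(ltW xyr).
  apply: le_trans (_ : B * `|x - y| `^ beta <= _); last first.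
    by rewrite lerDl; apply: mulr_ge0; [lra|apply: exprn_ge0; lra].
  apply: le_trans (_ : 2 * A / rho `^ beta * rho `^ beta <= _).
    by rewrite divfK// gt_eqF.
  apply: ler_pM => //; [exact: ltW|rewrite /B; lra].
move=> Ix Iy; apply/ler_addgt0Pr => e e0.
have lt1 : `|2^-1 : R| < 1 by rewrite ger0_norm; lra.
have /cvgrPdist_lt/(_ e e0)[n _ Hn] := cvg_geometric (2 * A) lt1.
apply: le_trans (H n x y Ix Iy) _; rewrite lerD2l.
have := Hn n (leqnn n); rewrite /geometric /= sub0r normrN => /ltW.
exact: le_trans (ler_norm _).
Qed.

End HolderEstimate.

(** * Conjugacies fix the critical point *)

(** By the mean value theorem, as the slope vanishes nowhere on a half. *)
Lemma in_U_inj_half {R : realType} (k : nat) (g : R -> R) (x y : R) :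
  in_U k.+1 g -> I x -> I y -> 0 <= x * y -> g x = g y -> x = y.
Proof.
move=> [[_ gl gr] _ g1 _ _] Ix Iy xy gxy.
set s := inf _ in g1.
have slope z : I z -> z != 0 -> derive_in I g z != 0.
  move=> Iz z0; rewrite -normr_gt0; apply: lt_le_trans (_ : s <= _); first lra.
  apply: ge_inf; last by exists z => //; split => // /eqP; exact/negP.
  by exists 0 => _ [? _ <-].
apply/eqP; apply: contraT => nxy.
wlog ltxy : x y Ix Iy xy gxy nxy / x < y.
  move=> H; move: (nxy); rewrite neq_lt => /orP[/H|/H]; first exact.
  by apply => //; [rewrite mulrC|rewrite eq_sym].
have Ixy := (Ix, Iy); move: Ixy; rewrite /I /= !in_itv /= => -[/andP[x1 x2] /andP[y1 y2]].
suff [c [cx cy dc]] : exists c, [/\ x < c, c < y &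
    derive_in I g c * (y - x) = 0 /\ c != 0].
  have Ic : I c by rewrite /I /= in_itv /=; lra.
  have := slope c Ic dc.2; move/eqP: dc.1; rewrite mulf_eq0 subr_eq0 (gt_eqF ltxy).
  by rewrite orbF => ->.
have [x0|x0] := leP 0 x.
- have [dg cg] := gr.
  have [c /andP[xc cy] E] := MVT_in _ _ _ (cg 0%N isT) (dg 0%N isT) _ _ x0 ltxy y2.
  have c0 : 0 < c by lra.
  have Ic : I c by rewrite /I /= in_itv /=; lra.
  exists c; split => //; rewrite gt_eqF//; split => //.
  have [_ -> _] := derive_in_I_half g c Ic (lt0r_neq0 c0). by rewrite c0 -E /= gxy subrr.
- have y0 : y <= 0.
    by move: xy; rewrite nmulr_rge0.
  have [dg cg] := gl.
  have [c /andP[xc cy] E] := MVT_in _ _ _ (cg 0%N isT) (dg 0%N isT) _ _ x1 ltxy y0.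
  have c0 : c < 0 by lra.
  have Ic : I c by rewrite /I /= in_itv /=; lra.
  exists c; split => //; rewrite lt_eqF//; split => //.
  have [_ -> _] := derive_in_I_half g c Ic (ltr0_neq0 c0).
  by rewrite ltNge (ltW c0) /= -E /= gxy subrr.
Qed.

Lemma IVT_in_I {R : realType} (g : R -> R) (a b y : R) :
  {within I, continuous g} -> -1 <= a -> a <= b -> b <= 1 ->
  Num.min (g a) (g b) <= y <= Num.max (g a) (g b) ->
  exists c, [/\ a <= c, c <= b, I c & g c = y].
Proof.
move=> gc a1 ab b1 yab.
have [|c] := IVT ab _ yab.
  apply: continuous_subspaceW gc => z; rewrite /I /= !in_itv /=.
  by move=> /andP[? ?]; lra.
rewrite in_itv /= => /andP[ac cb] gcy; exists c; split => //.
by rewrite /I /= in_itv /=; lra.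
Qed.

(** A value above [g 0] on one side would, since [g] starts from -1 at the end of
    that side, make [g] take the value [g 0] twice on that side. *)
Lemma in_U_crit_max {R : realType} (k : nat) (g : R -> R) (x : R) :
  in_U k.+1 g -> I x -> g x <= g 0.
Proof.
move=> Ug Ix; have [[gc _ _] [gm1 g1] _ _ gI] := Ug.
have Ig0 : I (g 0) by apply: gI; exists 0 => //; exact: crit_in_I.
have := (Ix, Ig0); rewrite /I /= !in_itv /= => -[/andP[x1 x2] /andP[g0 g0']].
rewrite leNgt; apply/negP => gx.
suff [c [Ic c0 xc gc0]] : exists c, [/\ I c, 0 <= c * 0, c != 0 & g c = g 0].
  by move/eqP: xc; apply; exact: (in_U_inj_half k g c 0 Ug Ic crit_in_I).
have x0 : x != 0 by apply: contraTneq gx => ->; rewrite ltxx.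
have [xp|xn] := leP 0 x.
- have [|c [xc c1 Ic E]] := IVT_in_I g x 1 (g 0) gc x1 x2 (lexx 1).
    by rewrite g1 ge_min g0 orbT le_max (ltW gx).
  exists c; split; rewrite ?mulr0// gt_eqF// (lt_le_trans _ xc)//.
  by rewrite lt_neqAle eq_sym x0.
- have [|c [c1 cx Ic E]] := IVT_in_I g (-1) x (g 0) gc (lexx _) x1 x2.
    by rewrite gm1 ge_min g0 le_max (ltW gx) orbT.
  by exists c; split; rewrite ?mulr0// lt_eqF// (le_lt_trans cx).
Qed.

Lemma in_U_two_preimages {R : realType} (k : nat) (g : R -> R) (x : R) :
  in_U k.+1 g -> I x -> x != 0 -> exists y, [/\ I y, y != x & g y = g x].
Proof.
move=> Ug Ix x0; have [[gc _ _] [gm1 g1] _ _ gI] := Ug.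
have Igx : I (g x) by apply: gI; exists x.
have := Igx; rewrite /I /= in_itv /= => /andP[gx _].
have gx0 := in_U_crit_max k g x Ug Ix.
have [xp|xn] := leP 0 x.
- have [|c [_ c0 Ic E]] := IVT_in_I g (-1) 0 (g x) gc (lexx _) (lerN10 _) ler01.
    by rewrite gm1 ge_min gx le_max gx0 orbT.
  by exists c; split => //; rewrite lt_eqF// (le_lt_trans c0)// lt_neqAle eq_sym x0.
- have [|c [c0 _ Ic E]] := IVT_in_I g 0 1 (g x) gc (lerN10 _) ler01 (lexx _).
    by rewrite g1 ge_min gx orbT le_max gx0.
  by exists c; split => //; rewrite gt_eqF// (lt_le_trans xn).
Qed.

(** If [h 0] were not 0, then [g (h 0)] would have a second preimage under [g],
    and [h] would carry it back to a second preimage of [f 0] under [f]; but 0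
    is the only preimage of [f 0], as [f] is injective on each side. *)
Lemma conjugacy_crit {R : realType} (f g h : R -> R) :
  in_U 2 f -> in_U 2 g -> homeo_I h -> (forall x, I x -> g (h x) = h (f x)) ->
  h 0 = 0.
Proof.
move=> Uf Ug [h' [[hI h'I] [h'h hh'] _ _]] gh.
have hI' x : I x -> I (h x) by move=> Ix; apply: hI; exists x.
have h'I' x : I x -> I (h' x) by move=> Ix; apply: h'I; exists x.
have fI x : I x -> I (f x) by case: Uf => _ _ _ _ fI Ix; apply: fI; exists x.
apply/eqP; apply: contraT => h0.
have [y [Iy yh0 gy]] := in_U_two_preimages 1 g (h 0) Ug (hI' _ crit_in_I) h0.
have fE : f (h' y) = f 0.
  rewrite -[LHS]h'h; last exact/fI/h'I'.
  rewrite -gh; last exact: h'I'.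
  by rewrite hh'// gy gh ?h'h//; [exact/fI/crit_in_I|exact: crit_in_I].
have := in_U_inj_half 1 f (h' y) 0 Uf (h'I' _ Iy) crit_in_I _ fE.
by rewrite mulr0 => /(_ (lexx 0)) E; rewrite -E hh'// eqxx in yh0.
Qed.

Lemma conjugacy_crit_orbit {R : realType} (f g h : R -> R) (j : nat) :
  in_U 2 f -> in_U 2 g -> homeo_I h -> (forall x, I x -> g (h x) = h (f x)) ->
  iter j f 0 = 0 -> iter j g 0 = 0.
Proof.
move=> Uf Ug hh gh fj.
have h0 := conjugacy_crit f g h Uf Ug hh gh.
have fI x : I x -> I (f x) by case: Uf => _ _ _ _ fI Ix; apply: fI; exists x.
have [_ E] : I (iter j f 0) /\ iter j g 0 = h (iter j f 0).
  elim: (j) => [|i [Ii IH]]; first by split; [exact: crit_in_I|rewrite /= h0].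
  by split => /=; [exact: fI|rewrite IH gh].
by rewrite E fj.
Qed.

(** * Uniformity in a neighbourhood *)

Lemma orbit_shadow {R : realType} (lam M e : R) (f g : R -> R) (j : nat) :
  1 <= M -> (forall x, I x -> I (f x)) -> expanding lam M g ->
  (forall x, I x -> `|g x - f x| <= e) ->
  `|iter j g 0 - iter j f 0| <= j%:R * e * M ^+ j.
Proof.
move=> M1 fI eg gf.
have e0 : 0 <= e := le_trans (normr_ge0 _) (gf _ crit_in_I).
elim: j => [|j IH] /=; first by rewrite subrr normr0 !mul0r.
have Ij : I (iter j f 0) by elim: (j) => [|i]; [exact: crit_in_I|exact: fI].
have Ij' := iter_stable _ _ _ j _ eg crit_in_I.
have := ler_distD (g (iter j f 0)) (g (iter j g 0)) (f (iter j f 0)).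
move=> /le_trans; apply.
rewrite -natr1 mulrDl mul1r mulrDl; apply: lerD.
- apply: le_trans (exp_lip _ _ _ eg _ _ Ij' Ij) _.
  by rewrite exprS mulrCA ler_wpM2l// (le_trans ler01).
- apply: le_trans (gf _ Ij) _; rewrite -[leLHS]mulr1 ler_wpM2l//.
  exact: exprn_ege1.
Qed.

Lemma orbit_gap {R : realType} (f : R -> R) (N : nat) :
  exists2 eta : R, 0 < eta &
    forall j, (j <= N)%N -> iter j f 0 != 0 -> eta <= `|iter j f 0|.
Proof.
elim: N => [|N [eta eta0 H]].
  by exists 1 => // j; rewrite leqn0 => /eqP ->; rewrite /= eqxx.
exists (if iter N.+1 f 0 == 0 then eta else Num.min eta `|iter N.+1 f 0|).
  by case: ifPn => // f0; rewrite lt_min eta0 normr_gt0.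
move=> j; rewrite leq_eqVlt => /orP[/eqP -> f0|].
  by rewrite (negbTE f0) ge_min lexx orbT.
rewrite ltnS => jN /(H _ jN) Hj; case: ifP => // _.
by rewrite ge_min Hj.
Qed.

(** A Hoelder function on [I] is bounded, so both suprema in [holder_norm] are
    genuine. *)
Lemma holder_normP {R : realType} (beta : R) (v : R -> R) :
  0 < beta -> is_holder beta v ->
  (forall x, I x -> `|v x| <= holder_norm beta v) /\
  (forall x y, I x -> I y ->
     `|v x - v y| <= holder_norm beta v * `|x - y| `^ beta).
Proof.
move=> beta0 [H HH].
set sem := [set r | exists x y, [/\ I x, I y, x != y &
  r = `|v x - v y| / `|x - y| `^ beta]].
have ubs : has_ubound sem.
  exists H => _ [x [y [Ix Iy xy ->]]].
  by rewrite ler_pdivrMr ?HH// powR_gt0// normr_gt0 subr_eq0.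
have ubv : has_ubound [set `|v x| | x in I].
  exists (`|v 0| + `|H|) => _ [x Ix <-].
  rewrite -[v x](subrK (v 0)) (le_trans (ler_normD _ _))// addrC lerD2l.
  apply: le_trans (HH _ _ Ix crit_in_I) _; rewrite subr0.
  apply: le_trans (_ : `|H| * `|x| `^ beta <= _).
    by rewrite ler_wpM2r ?powR_ge0// ler_norm.
  have p1 : 1 `^ beta = 1 :> R by rewrite powR1.
  rewrite -[leRHS]mulr1 ler_wpM2l// -p1.
  apply: ge0_ler_powR; rewrite ?nnegrE ?(ltW beta0)//.
  by move: Ix; rewrite /I /= in_itv /= ler_norml.
have sv x : I x -> `|v x| <= sup_norm I v.
  by move=> Ix; apply: ub_le_sup ubv _ _; exists x.
have ss x y : I x -> I y -> x != y ->
    `|v x - v y| / `|x - y| `^ beta <= holder_seminorm beta v.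
  by move=> Ix Iy xy; apply: ub_le_sup ubs _ _; exists x, y.
have sv0 : 0 <= sup_norm I v := le_trans (normr_ge0 _) (sv _ crit_in_I).
have ss0 : 0 <= holder_seminorm beta v.
  have I1 : I (1 : R) by rewrite /I /= in_itv /=; lra.
  apply: le_trans (ss 1 0 I1 crit_in_I (oner_neq0 _)).
  by rewrite divr_ge0// powR_ge0.
split=> [x Ix|x y Ix Iy]; rewrite /holder_norm.
  by rewrite (le_trans (sv x Ix))// lerDl.
have [<-|xy] := eqVneq x y.
  by rewrite !subrr normr0 mulr_ge0 ?powR_ge0// addr_ge0.
rewrite -ler_pdivrMr ?powR_gt0 ?normr_gt0 ?subr_eq0//.
by rewrite (le_trans (ss x y Ix Iy xy))// lerDr.
Qed.

Lemma holder_norm_le {R : realType} (beta A B : R) (u : R -> R) :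
  (forall x, I x -> `|u x| <= A) ->
  (forall x y, I x -> I y -> `|u x - u y| <= B * `|x - y| `^ beta) ->
  holder_norm beta u <= A + B.
Proof.
move=> uA uB; apply: lerD; apply: ge_sup.
- by exists `|u 0|, 0 => //; exact: crit_in_I.
- by move=> _ [x Ix <-]; exact: uA.
- have I1 : I (1 : R) by rewrite /I /= in_itv /=; lra.
  exists (`|u 1 - u 0| / `|1 - 0| `^ beta), 1, 0.
  by split => //; exact: crit_in_I.
- move=> _ [x [y [Ix Iy xy ->]]].
  by rewrite ler_pdivrMr ?uB// powR_gt0// normr_gt0 subr_eq0.
Qed.

(** [kappa] is the midpoint between [lam^(beta - 1)] and 1, and [r] is the scale
    at which the distortion [1 + M * r] uses up exactly the room between. *)
Lemma contraction_exists {R : realType} (lam M beta : R) :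
  1 < lam -> 1 <= M -> 0 < beta -> beta < 1 ->
  exists kappa delta, contraction lam M beta kappa delta.
Proof.
move=> lam1 M1 beta0 beta1.
have lam0 : 0 < lam by lra.
set k0 := lam `^ (beta - 1).
have k00 : 0 < k0 by exact: powR_gt0.
have k01 : k0 < 1.
  rewrite /k0 (_ : beta - 1 = - (1 - beta)); last by ring.
  have p1 : 1 `^ (1 - beta) = 1 :> R by rewrite powR1.
  rewrite powRN invf_lt1 ?powR_gt0// -{1}p1.
  by apply: gt0_ltr_powR; rewrite ?nnegrE ?subr_gt0 ?(ltW lam0).
set r := (1 - k0) / (2 * k0 * M).
have M0 : 0 < M by lra.
have r0 : 0 < r by rewrite divr_gt0 ?mulr_gt0//; lra.
exists ((1 + k0) / 2), (Num.min 1 r); split=> //; try lra.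
- by rewrite lt_min ltr01.
- by rewrite ge_min lexx.
- apply: le_trans (_ : (1 + M * r) * k0 <= _).
    by rewrite ler_wpM2r ?(ltW k00)// lerD2l ler_wpM2l ?(ltW M0)// ge_min lexx orbT.
  rewrite /r le_eqVlt; apply/orP; left; apply/eqP; field.
  by rewrite !gt_eqF.
Qed.

(** The zeros of the critical orbit of [f] must remain zeros for [g], while a
    nonzero value needs only to stay away from 0.  The latter has to be ensured
    up to time [N] only, and [N] depends on [lam], [M] and [beta] alone, so it is
    fixed before the size [xi] of the neighbourhood is chosen. *)
Lemma uniform_holder_tce {R : realType} (f : R -> R) (beta : R) :
  in_U 2 f -> 0 < beta -> beta < 1 ->
  exists C xi : R, [/\ 0 < C, 0 < xi &
    forall g v, in_U 2 g -> B_norm 2 (g \- f) < xi ->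
      (forall j, iter j f 0 = 0 -> iter j g 0 = 0) ->
      is_holder beta v -> J g v = 0 -> holder_tce_bound beta C g v].
Proof.
move=> Uf beta0 beta1.
have [lam [M [xi0 [lam1 M1 xi00 near_f]]]] := in_U2_expanding f Uf.
have [kappa [delta ctr]] := contraction_exists lam M beta lam1 M1 beta0 beta1.
have kappa0 := kappa_gt0 ctr; have kappa1 := ctr_kappa1 _ _ _ _ _ ctr.
have [N kN] : exists N, 2 * kappa ^+ N <= 2^-1.
  have lt1 : `|kappa| < 1 by rewrite gtr0_norm.
  have e0 : (0 : R) < 2^-1 by lra.
  have /cvgrPdist_lt/(_ _ e0)[n _ Hn] := cvg_geometric 2 lt1.
  exists n; have := Hn n (leqnn n); rewrite /geometric /= sub0r normrN => /ltW.
  exact: le_trans (ler_norm _).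
have [eta2 eta20 gap] := orbit_gap f N.
(* half of the gap is kept for g *)
pose eta := eta2 / 2.
have eta0 : 0 < eta by rewrite /eta; lra.
have delta0 := ctr_delta0 _ _ _ _ _ ctr.
have M0 : 0 < M by lra.
pose rho := Num.min delta eta / M ^+ (N + N).
have MN0 n : 0 < M ^+ n by rewrite exprn_gt0.
have rho0 : 0 < rho by rewrite divr_gt0// lt_min delta0.
have rhoE : M ^+ (N + N) * rho = Num.min delta eta.
  by rewrite mulrC divfK// gt_eqF.
(* at this distance the critical orbits of f and g stay eta-close up to time N *)
pose xi1 := eta / (N.+1%:R * M ^+ N).
have xi10 : 0 < xi1 by rewrite divr_gt0// mulr_gt0.
pose a := (lam - 1)^-1.
have a0 : 0 < a by rewrite invr_gt0; lra.
pose b := 6 * ((1 + M * a) / (1 - kappa)) + 2 * a / rho `^ beta.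
have b0 : 0 < b.
  have Ma : 0 < M * a by exact: mulr_gt0.
  apply: addr_gt0; last by apply: divr_gt0; [lra|exact: powR_gt0].
  by apply: mulr_gt0; [lra|apply: divr_gt0; lra].
exists (a + b), (Num.min xi0 xi1); split; first lra.
  by rewrite lt_min xi00.
move=> g v Ug; rewrite lt_min => /andP[gxi0 gxi1] per hv Jv.
have [eg gf] := near_f g Ug gxi0.
have fI x : I x -> I (f x) by case: Uf => _ _ _ _ fI Ix; apply: fI; exists x.
set Nv := holder_norm beta v.
have [vN vH] := holder_normP beta v beta0 hv.
rewrite -/Nv in vN vH.
have [alpha sol] := tce_solution_exists lam M Nv g v lam1 eg vN.
have aA := tce_solution_bound lam M Nv g v alpha lam1 eg vN sol.
have crit j : (j <= N)%N -> iter j g 0 = 0 \/ eta <= `|iter j g 0|.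
  move=> jN; have [fj|fj] := eqVneq (iter j f 0) 0; [left; exact: per|right].
  have := gap j jN fj; have := orbit_shadow lam M _ f g j M1 fI eg gf.
  have : j%:R * B_norm 2 (g \- f) * M ^+ j <= eta.
    have e0 : 0 <= B_norm 2 (g \- f) := le_trans (normr_ge0 _) (gf _ crit_in_I).
    rewrite [leRHS](_ : _ = N.+1%:R * xi1 * M ^+ N); last first.
      by rewrite /xi1; field; rewrite ?gt_eqF ?MN0//; lra.
    apply: ler_pM; rewrite ?mulr_ge0 ?(ltW (MN0 _))//.
    - apply: ler_pM => //; last exact: ltW.
      by rewrite ler_nat leqW.
    - exact: ler_weXn2l.
  rewrite (_ : eta2 = 2 * eta); last by rewrite /eta; lra.
  have := lerB_dist (iter j f 0) (iter j g 0); rewrite distrC; lra.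
have [_ al0 tce] := sol.
have csol : continuous_tce beta Nv (Nv / (lam - 1)) g v alpha.
  split=> //; apply/eqP; rewrite -subr_eq0; apply/eqP.
  by rewrite -(J_eq lam M g v alpha lam1 eg sol).
have rd : M ^+ (N + N) * rho <= delta by rewrite rhoE ge_min lexx.
have re : M ^+ (N + N) * rho <= eta by rewrite rhoE ge_min lexx orbT.
have aH := holder_of_tce ctr eg csol kN crit rho0 rd re.
exists alpha; split => //.
- by move=> alpha' sol'; exact: (tce_solution_unique lam M g v).
- by eexists; exact: aH.
- have -> : (a + b) * holder_norm beta v = Nv / (lam - 1) +
      (6 * pullback_const M kappa Nv (Nv / (lam - 1)) +
       2 * (Nv / (lam - 1)) / rho `^ beta).
    by rewrite /b /a /pullback_const -/Nv; ring.
  exact: holder_norm_le aA aH.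
Qed.

Theorem proposition2p3 (R : realType) (f : R -> R) (hf : in_U 2 f) :
  (~ crit_periodic f ->
   forall beta : R, 0 < beta -> beta < 1 ->
   exists (C : R) (V : set (R -> R)),
     [/\ 0 < C, nbhd_in_U 2 f V &
         forall g v : R -> R, V g -> is_holder beta v ->
           v (-1) = 0 -> v 1 = 0 -> J g v = 0 ->
           holder_tce_bound beta C g v])
  /\
  (crit_periodic f ->
   forall beta : R, 0 < beta -> beta < 1 ->
   exists C xi : R,
     [/\ 0 < C, 0 < xi &
         let V := [set g : R -> R |
                     [/\ in_U 2 g, B_norm 2 (g \- f) < xi &
                         exists h : R -> R, homeo_I h /\
                           forall x, I x -> g (h x) = h (f x)]] in
         forall g v : R -> R, V g -> is_holder beta v ->
           v (-1) = 0 -> v 1 = 0 -> J g v = 0 ->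
           holder_tce_bound beta C g v]).
Proof.
split=> [nper|_] beta beta0 beta1;
  have [C [xi [C0 xi0 H]]] := uniform_holder_tce f beta hf beta0 beta1.
- exists C, [set g | in_U 2 g /\ B_norm 2 (g \- f) < xi]; split=> //.
    by split=> [g []//|]; exists xi.
  move=> g v [Ug gf] hv _ _ Jv; apply: H => // -[//|j] fj.
  by case: nper; exists j.+1; rewrite /crit_orbit fj eqxx.
- exists C, xi; split=> // V g v [Ug gf [h [hh gh]]] hv _ _ Jv.
  by apply: H => // j; exact: conjugacy_crit_orbit hf Ug hh gh.
Qed.
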